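(* Let $K$ be a global function field of characteristic $p$, let $v$ be a normalized nontrivial valuation on $K$, let $K_v$ be the completion of $K$ at $v$ and $A_v$ its valuation ring. Let $\pi\in K_v$ with $v(\pi)$ a positive integer, and let $\Gamma\subset A_v$ be a complete set of representatives of $A_v/\pi A_v$. Suppose $\Gamma$ is additively closed, i.e. $\mu+\nu\in\Gamma$ for all $\mu,\nu\in\Gamma$. Then $(\Gamma,\pi)$ has property B if and only if $\pi$ and all elements of $\Gamma$ are algebraic over $K$.
   Context: A global function field of characteristic $p$ is a field $K\supset\mathbb{F}_p$ containing an element $x$ transcendental over $\mathbb{F}_p$ with $[K:\mathbb{F}_p(x)]<\infty$. A valuation on $K$ is a map $v:K^*\to\mathbb{Z}$ with $v(ab)=v(a)+v(b)$ and $v(a+b)\ge\min\{v(a),v(b)\}$, with $v(0)=+\infty$; it is normalized if $v(K^* )=\mathbb{Z}$. The valuation extends to the completion $K_v$, with valuation ring $A_v$. A complete set of representatives of $A_v/\pi A_v$ is a subset $\Gamma\subset A_v$ containing exactly one element of each residue class modulo $\pi A_v$ (it is finite). An expansion of $x\in K_v$ with respect to $(\Gamma,\pi)$ is a representation $x=\sum_{n\ge m}a_n\pi^n$ with $m\in\mathbb{Z}$ and $a_n\in\Gamma$ for all $n\ge m$; for each $m$ with $x\in\pi^mA_v$ there is exactly one such expansion starting at $m$. Its sequence of coefficients is $\{a_n\}_{n\ge m}$. A sequence $\{a_n\}_{n\ge m}$ is $p$-automatic if its $p$-kernel, i.e. the set of sequences $\{a_{np^i+j+m}\}_{n\ge0}$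 with $i\ge0$ and $0\le j<p^i$, is finite. $(\Gamma,\pi)$ has property B if for every $x\in K_v$ and every expansion $x=\sum_{n\ge m}a_n\pi^n$ with respect to $(\Gamma,\pi)$: $x$ is algebraic over $K$ if and only if $\{a_n\}_{n\ge m}$ is $p$-automatic. *)

(* Defs.v *)
From HB Require Import structures.
From mathcomp Require Import all_boot all_order all_algebra.
From mathcomp Require Import classical_sets cardinality.

Set Implicit Arguments.
Unset Strict Implicit.
Unset Printing Implicit Defensive.

Import Order.TTheory GRing.Theory Num.Theory.
Local Open Scope classical_set_scope.
Local Open Scope ring_scope.

(* f(x)/g(x) with g(x) = 0 evaluates to 0, so no side condition is needed. *)
Definition simple_ext (F E : fieldType) (f : {rmorphism F -> E}) (x : E) :
    set E :=
  [set y | exists P Q : {poly F}, y = (map_poly f P).[x] / (map_poly f Q).[x]].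

Definition finite_degree_over (E : fieldType) (F : set E) : Prop :=
  exists (d : nat) (e : 'I_d -> E), forall z : E,
    exists2 c : 'I_d -> E, (forall i, F (c i)) & z = \sum_(i < d) c i * e i.

(* The ring morphism 'F_p -> K is the inclusion of the prime field; 'F_p is
   the field with p elements only when p is prime. *)
Definition global_function_field (p : nat) (K : fieldType) : Prop :=
  prime p /\
  exists (f : {rmorphism 'F_p -> K}) (x : K),
    ~ algebraicOver f x /\ finite_degree_over (simple_ext f x).

(* A map v : K^* -> Z is encoded as a total map K -> int whose value at 0 is
   irrelevant; the convention v(0) = +oo is built into val_ge. *)
Definition val_ge (K : fieldType) (v : K -> int) (n : int) (x : K) : bool :=
  (x == 0) || (n <= v x).

Definition valuation (K : fieldType) (v : K -> int) : Prop :=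
  (forall a b, a != 0 -> b != 0 -> v (a * b) = v a + v b) /\
  (forall a b, a != 0 -> b != 0 -> a + b != 0 ->
     Num.min (v a) (v b) <= v (a + b)).

Definition normalized (K : fieldType) (v : K -> int) : Prop :=
  forall n : int, exists2 a : K, a != 0 & v a = n.

Definition nontrivial_val (K : fieldType) (v : K -> int) : Prop :=
  exists2 a : K, a != 0 & v a != 0.

Definition val_cvg (K : fieldType) (v : K -> int) (u : nat -> K) (l : K) :
    Prop :=
  forall N : int, exists n0 : nat, forall n,
    (n0 <= n)%N -> val_ge v N (u n - l).

Definition val_cauchy (K : fieldType) (v : K -> int) (u : nat -> K) : Prop :=
  forall N : int, exists n0 : nat, forall m n,
    (n0 <= m)%N -> (n0 <= n)%N -> val_ge v N (u m - u n).

(* (Kv, w, iota) is a completion of (K, v): a complete valued field in which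
   K embeds densely, w extending v. Such a triple is unique up to unique
   isomorphism. *)
Record is_completion (K : fieldType) (v : K -> int) (Kv : fieldType)
    (w : Kv -> int) (iota : {rmorphism K -> Kv}) : Prop := IsCompletion {
  completion_valuation : valuation w;
  completion_extends : forall a : K, a != 0 -> w (iota a) = v a;
  completion_dense : forall (x : Kv) (N : int),
    exists a : K, val_ge w N (x - iota a);
  completion_complete : forall u : nat -> Kv,
    val_cauchy w u -> exists l : Kv, val_cvg w u l
}.

Definition val_ring (Kv : fieldType) (w : Kv -> int) : set Kv :=
  [set x | val_ge w 0 x].

Definition complete_reps (Kv : fieldType) (w : Kv -> int) (pi : Kv)
    (Gamma : set Kv) : Prop :=
  Gamma `<=` val_ring w /\
  forall x, val_ring w x ->
    exists! g, Gamma g /\ exists2 y, val_ring w y & x - g = pi * y.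

(* A sequence {a_n}_{n >= m} is represented by a : nat -> Kv, with a k standing
   for a_{m + k}. *)
Definition expansion (Kv : fieldType) (w : Kv -> int) (Gamma : set Kv)
    (pi x : Kv) (m : int) (a : nat -> Kv) : Prop :=
  (forall k, Gamma (a k)) /\
  val_cvg w (fun n => \sum_(k < n) a k * pi ^ (m + k%:Z)) x.

Definition p_kernel (T : Type) (p : nat) (a : nat -> T) : set (nat -> T) :=
  [set s | exists i j : nat,
     (j < p ^ i)%N /\ s = (fun n => a (n * p ^ i + j)%N)].

Definition automatic (T : Type) (p : nat) (a : nat -> T) : Prop :=
  finite_set (p_kernel p a).

Definition property_B (p : nat) (K Kv : fieldType) (iota : {rmorphism K -> Kv})
    (w : Kv -> int) (Gamma : set Kv) (pi : Kv) : Prop :=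
  forall (x : Kv) (m : int) (a : nat -> Kv),
    expansion w Gamma pi x m a -> (algebraicOver iota x <-> automatic p a).

(* Main.v *)
Require Import Defs.
From HB Require Import structures.
From mathcomp Require Import all_boot all_order all_algebra.
From mathcomp Require Import ring zify.
From mathcomp Require Import boolp classical_sets cardinality.

Set Implicit Arguments.
Unset Strict Implicit.
Unset Printing Implicit Defensive.

Import Order.TTheory GRing.Theory Num.Theory.
Local Open Scope classical_set_scope.
Local Open Scope ring_scope.

(* If (Gamma, pi) has property B, then the finite expansions g and g * pi with
   g in Gamma are automatic, so g and pi are algebraic.

   Conversely Gamma is a finite F_p-vector space; let g_1, ..., g_r be a basis.
   Then A_v is free over F_p[[pi]] with basis g_i, so x = sum_i z_i g_i where the
   digits of the series z_i in F_p[[pi]] are the coordinates of the digits of x.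
   By Christol's theorem it remains to see that x is algebraic iff all z_i are.

   Suppose that pi is not a p-th power.  Algebraic elements satisfy separable
   additive equations, so that x, the g_i and their iterated p-th powers form a
   finite family e with delta e = A e^(p), A and delta over F_p[pi].  For the
   matrix c of coordinates this reads delta c = A c^(p) G with an unknown square
   matrix G over F_p[[pi]].  Taking maximal minors, the vector omega of minors
   satisfies omega = lam A' omega^(p) with an unknown scalar lam.  Then the
   elements lam^(1 + p + ... + p^(i-1)) omega^(p^i), i <= N, lie in the
   F_p[pi]-span of N elements; a linear relation between them shows first that lam
   is algebraic (one of the minors is 1), then that omega is, and the entries of c
   are minors.

   If pi = s^p, then induction on v(pi) applies to s, and an algebraic basis f_i
   modulo s gives the algebraic basis s^b f_i (b < p) modulo pi; the Cartier
   operators for s preserve algebraicity. *)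

(** * Linear dependence over a subring *)

Section Dependence.
Variable E : fieldType.
Implicit Types S V : set E.

Definition is_subring S :=
  [/\ S 1, forall x y, S x -> S y -> S (x - y)
    & forall x y, S x -> S y -> S (x * y)].

Lemma subring0 S : is_subring S -> S 0.
Proof. by case=> S1 SB _; rewrite -(subrr 1); apply: SB. Qed.

Lemma subringN S x : is_subring S -> S x -> S (- x).
Proof.
move=> hS Sx; rewrite -sub0r; case: (hS) => _ SB _.
by apply: SB => //; apply: subring0.
Qed.

Lemma subringD S x y : is_subring S -> S x -> S y -> S (x + y).
Proof.
move=> hS Sx Sy; rewrite -[y]opprK; case: (hS) => _ SB _.
by apply: SB => //; apply: subringN.
Qed.

Lemma subringM S x y : is_subring S -> S x -> S y -> S (x * y).
Proof. by case=> _ _; apply. Qed.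

Lemma subring_sum S (I : Type) (r : seq I) (P : pred I) (F : I -> E) :
  is_subring S -> (forall i, P i -> S (F i)) -> S (\sum_(i <- r | P i) F i).
Proof.
move=> hS SF; elim/big_ind: _ => //; first exact: subring0.
by move=> x y; apply: subringD.
Qed.

Lemma subring_prod S (I : Type) (r : seq I) (P : pred I) (F : I -> E) :
  is_subring S -> (forall i, P i -> S (F i)) -> S (\prod_(i <- r | P i) F i).
Proof.
move=> hS SF; elim/big_ind: _ => //; first by case: hS.
by move=> x y; apply: subringM.
Qed.

Lemma subringX S x n : is_subring S -> S x -> S (x ^+ n).
Proof.
move=> hS Sx; elim: n => [|n IH]; first by rewrite expr0; case: hS.
by rewrite exprS; apply: subringM.
Qed.

Definition in_span S (I : finType) (g : I -> E) (y : E) :=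
  exists2 c : I -> E, (forall i, S (c i)) & y = \sum_i c i * g i.

Definition dependent S (I : finType) (y : I -> E) :=
  exists c : I -> E,
    [/\ forall i, S (c i), exists i, c i != 0 & \sum_i c i * y i = 0].

Lemma in_spanD S (I : finType) (g : I -> E) x y : is_subring S ->
  in_span S g x -> in_span S g y -> in_span S g (x + y).
Proof.
move=> hS [c Sc ->] [d Sd ->]; exists (fun i => c i + d i).
  by move=> i; apply: subringD.
by rewrite -big_split; apply: eq_bigr => i _; rewrite mulrDl.
Qed.

Lemma in_spanZ S (I : finType) (g : I -> E) a y : is_subring S ->
  S a -> in_span S g y -> in_span S g (a * y).
Proof.
move=> hS Sa [c Sc ->]; exists (fun i => a * c i).
  by move=> i; apply: subringM.
by rewrite big_distrr; apply: eq_bigr => i _; rewrite /= mulrA.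
Qed.

Lemma in_span0 S (I : finType) (g : I -> E) : is_subring S -> in_span S g 0.
Proof.
move=> hS; exists (fun=> 0) => [_|]; first exact: subring0.
by rewrite big1 // => i _; rewrite mul0r.
Qed.

Lemma in_span_sum S (I : finType) (g : I -> E) (J : Type) (r : seq J)
    (P : pred J) (y : J -> E) : is_subring S ->
  (forall j, P j -> in_span S g (y j)) ->
  in_span S g (\sum_(j <- r | P j) y j).
Proof.
move=> hS gy; elim/big_ind: _ => //; first exact: in_span0.
by move=> x z; apply: in_spanD.
Qed.

Lemma in_span_gen S (I : finType) (g : I -> E) i : is_subring S ->
  in_span S g (g i).
Proof.
move=> hS; exists (fun j => (j == i)%:R) => [j|].
  by case: (j == i); [case: hS | apply: subring0].
rewrite (bigD1 i) //= eqxx mul1r big1 ?addr0 // => j /negPf ->.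
by rewrite mul0r.
Qed.

Lemma in_span_trans S (I J : finType) (g : I -> E) (h : J -> E) y :
  is_subring S -> in_span S g y -> (forall i, in_span S h (g i)) ->
  in_span S h y.
Proof.
move=> hS [c Sc ->] gh; apply: in_span_sum => // i _.
by apply: in_spanZ.
Qed.

(** Fraction-free elimination by induction on the number of generators, since [S] is only a ring. If
    the first generator occurs in some [y i0], cross-multiplying with [y i0] removes it from the
    other vectors; if it occurs nowhere, it is dropped. *)
Lemma dependent_ord S N n (g : 'I_N -> E) (y : 'I_n -> E) :
  is_subring S -> (N < n)%N -> (forall i, in_span S g (y i)) -> dependent S y.
Proof.
move=> hS; elim: N n g y => [|N IH] [|n] // g y ltNn gy.
  exists (fun=> 1); split=> [_||]; first by case: hS.
    by exists ord0; exact: oner_neq0.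
  by rewrite big1 // => i _; case: (gy i) => c _ ->; rewrite big_ord0 mulr0.
have {gy} [C SC yE] : exists2 C : 'I_n.+1 -> 'I_N.+1 -> E,
    (forall i j, S (C i j)) & forall i, y i = \sum_j C i j * g j.
  have [C HC] := fin_all_exists2 gy.
  by exists C.
have [[i0 Ci0]|C0] := pselect (exists i, C i ord0 != 0); last first.
  apply: (IH n.+1 (fun j => g (lift ord0 j))); first exact: ltnW.
  move=> i; exists (fun j => C i (lift ord0 j)) => //.
  rewrite yE big_ord_recl.
  have [->|nz] := eqVneq (C i ord0) 0; first by rewrite mul0r add0r.
  by case: C0; exists i.
pose y' k := C i0 ord0 * y (lift i0 k) - C (lift i0 k) ord0 * y i0.
have [||c [Sc [k0 ck0] cy]] := IH n (fun j => g (lift ord0 j)) y'.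
- by [].
- move=> k; exists (fun j => C i0 ord0 * C (lift i0 k) (lift ord0 j)
                 - C (lift i0 k) ord0 * C i0 (lift ord0 j)).
    by move=> j; case: (hS) => _ SB SM; apply: SB; apply: SM.
  rewrite /y' !yE !big_ord_recl !mulrDr !mulrA.
  rewrite [C (lift _ _) ord0 * _]mulrC opprD addrACA subrr add0r.
  rewrite !big_distrr /= -sumrB; apply: eq_bigr => j _.
  by rewrite mulrBl !mulrA.
exists (fun i => if unlift i0 i is Some k then c k * C i0 ord0
                 else - \sum_k c k * C (lift i0 k) ord0); split.
- move=> i; case: (unlift i0 i) => [k|]; first by apply: subringM.
  by apply: subringN => //; apply: subring_sum => // k _; apply: subringM.
- by exists (lift i0 k0); rewrite liftK mulf_neq0.
rewrite (bigD1_ord i0) //= unlift_none mulNr addrC -[RHS]cy big_distrl -sumrB.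
apply: eq_bigr => k _ /=; rewrite liftK /y' mulrBr !mulrA.
by [].
Qed.

Lemma dependent_span S (I J : finType) (g : I -> E) (y : J -> E) :
  is_subring S -> (#|I| < #|J|)%N -> (forall j, in_span S g (y j)) ->
  dependent S y.
Proof.
move=> hS lt gy.
have [|c [Sc [i ci] cy]] :=
  @dependent_ord S #|I| #|J| (g \o enum_val) (y \o enum_val) hS lt.
  move=> i; have [c Sc yE] := gy (enum_val i).
  exists (c \o enum_val) => [j|]; first exact: Sc.
  rewrite /= yE (reindex (@enum_val I predT)) //; exact/onW_bij/enum_val_bij.
exists (c \o enum_rank); split => [j||]; first exact: Sc.
  by exists (enum_val i); rewrite /= enum_valK.
rewrite (reindex (@enum_val J predT)) /=; last exact/onW_bij/enum_val_bij.
by rewrite -[RHS]cy; apply: eq_bigr => k _; rewrite /= enum_valK.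
Qed.

(* Common denominators are taken over finite families, so that [V] may be
   closed under division although only [S]-combinations are used. *)
Definition finite_over S V (I : finType) (g : I -> E) :=
  forall (J : finType) (y : J -> E), (forall i, V (y i)) ->
  exists2 u, u != 0 & forall i, in_span S g (u * y i).

Lemma finite_over_dependent S V (I J : finType) (g : I -> E) (y : J -> E) :
  is_subring S -> finite_over S V g -> (forall i, V (y i)) ->
  (#|I| < #|J|)%N -> dependent S y.
Proof.
move=> hS fV Vy lt; have [u u0 uy] := fV J y Vy.
have [c [Sc ci cy]] := dependent_span hS lt uy.
exists c; split=> //; apply: (mulfI u0); rewrite mulr0 -[RHS]cy big_distrr /=.
by apply: eq_bigr => i _; rewrite mulrCA.
Qed.

(** Vanishing top coefficients are discarded, and the highest one that survives is [a]: thus [x]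
    becomes integral once [a] is inverted. *)
Lemma dependent_powers S m x : is_subring S ->
  dependent S (fun i : 'I_m => x ^+ i) ->
  exists d a, [/\ S a, a != 0
    & in_span S (fun b : 'I_d => x ^+ b) (a * x ^+ d)].
Proof.
move=> hS; elim: m => [|m IH] [c [Sc [i ci] cx]]; first by case: i ci.
move: cx; rewrite big_ord_recr /= => cx.
have [c0|c0] := eqVneq (c ord_max) 0.
  apply: IH; exists (fun i => c (widen_ord (leqnSn m) i)); split => //.
    have lti : (i < m)%N.
      have := ltn_ord i; rewrite ltnS leq_eqVlt => /predU1P [im|//].
      by case/eqP: ci; rewrite -c0; congr c; apply/val_inj.
    exists (Ordinal lti); move: ci; congr (c _ != 0); exact/val_inj.
  by rewrite -[RHS]cx c0 mul0r addr0.
exists m, (c ord_max); split => //.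
exists (fun i => - c (widen_ord (leqnSn m) i)) => [k|]; first exact: subringN.
apply/eqP; rewrite -subr_eq0; apply/eqP; rewrite -[RHS]cx addrC; congr (_ + _).
by rewrite -sumrN; apply: eq_bigr => k _; rewrite mulNr opprK.
Qed.

(** Each reduction of [x ^+ d] to lower powers costs one factor [a], and [k] such factors suffice
    for [x ^+ k]. *)
Lemma in_span_powers S d a x k : is_subring S -> S a -> a != 0 ->
  in_span S (fun b : 'I_d => x ^+ b) (a * x ^+ d) ->
  in_span S (fun b : 'I_d => x ^+ b) (a ^+ k * x ^+ k).
Proof.
case: d => [|d] hS Sa a0 ax.
  case: ax => c _; rewrite big_ord0 expr0 mulr1 => a00.
  by rewrite a00 eqxx in a0.
elim: k => [|k [c Sc IH]].
  by rewrite !expr0 mul1r; exact: (@in_span_gen _ _ _ ord0).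
rewrite 2!exprS mulrACA IH big_distrr; apply: in_span_sum => // b _ /=.
rewrite mulrCA; apply: in_spanZ => //; rewrite -mulrA -exprS.
have := ltn_ord b; rewrite ltnS leq_eqVlt => /predU1P [->|lt] //.
apply: in_spanZ => //; exact: (@in_span_gen S _ _ (Ordinal (lt : b.+1 < d.+1)%N)).
Qed.

End Dependence.

(** * Self-similar vectors *)

Section AlgebraicallyClosedIn.
Variable E : fieldType.

(** Most of the proof sees the elements algebraic over [K] only through this closure. Inverses come
    along, as roots of [z X - 1]. *)
Definition alg_closed_in (L : set E) := is_subring L /\
  forall (P : {poly E}) z, P != 0 -> (forall i, L P`_i) -> root P z -> L z.

Lemma algebraicOver_closed (F : fieldType) (f : {rmorphism F -> E}) :
  alg_closed_in (algebraicOver f).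
Proof.
split; first split.
- exact: algebraic1.
- by move=> x y; apply: algebraic_sub.
- by move=> x y; apply: algebraic_mul.
move=> P z P0 LP Pz; apply/integral_algebraic.
pose Q := (lead_coef P)^-1 *: P.
have lP0 : lead_coef P != 0 by rewrite lead_coef_eq0.
apply: (@integral_root_monic _ _ _ z Q).
- by rewrite monicE lead_coefZ mulVf.
- by rewrite rootZ ?invr_eq0.
apply/integral_poly => i; apply/integral_algebraic; rewrite coefZ.
by apply: algebraic_mul => //; apply: algebraic_inv; apply: LP.
Qed.

Variable L : set E.
Hypothesis hL : alg_closed_in L.

(** Distinct exponents keep the monomials from cancelling, so one nonzero [c i] makes the polynomial
    nonzero. *)
Lemma alg_closed_sparse n (e : 'I_n -> nat) (c : 'I_n -> E) z :
  injective e -> (forall i, L (c i)) -> (exists i, c i != 0) ->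
  \sum_i c i * z ^+ e i = 0 -> L z.
Proof.
move=> inj_e Lc [i0 ci0] cz; case: (hL) => hS HL.
pose P := \sum_i c i *: 'X^(e i) : {poly E}.
have PE k : P`_k = \sum_i c i * (k == e i)%:R.
  by rewrite coef_sum; apply: eq_bigr => i _; rewrite coefZ coefXn.
apply: (HL P).
- apply/eqP => /(congr1 (fun q : {poly E} => q`_(e i0))).
  rewrite coef0 PE (bigD1 i0) //= eqxx mulr1 big1 ?addr0 => [/eqP|i ne].
    exact/negP.
  by rewrite inj_eq // eq_sym (negPf ne) mulr0.
- move=> k; rewrite PE; apply: subring_sum => // i _.
  by apply: subringM => //; case: (_ == _); [case: hS | apply: subring0].
rewrite /root horner_sum; apply/eqP; rewrite -[RHS]cz.
by apply: eq_bigr => i _; rewrite hornerZ hornerXn.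
Qed.

Lemma alg_closedV z : L z -> L z^-1.
Proof.
move=> Lz; have [->|z0] := eqVneq z 0.
  by rewrite invr0; apply: subring0; case: hL.
case: (hL) => hS _.
apply: (@alg_closed_sparse 2 val (fun i => if val i == 0%N then -1 else z)).
- exact: val_inj.
- by move=> i; case: ifP => _ //; apply: subringN => //; case: hS.
- by exists ord_max.
by rewrite !big_ord_recl big_ord0 /= mulr1 addr0 expr1 divff // addrC subrr.
Qed.

Lemma alg_closed_div x y : L x -> L y -> L (x / y).
Proof. by move=> Lx Ly; apply: subringM (alg_closedV Ly); case: hL. Qed.

End AlgebraicallyClosedIn.

Section Frobenius.
Variables (E : fieldType) (p : nat).
Hypothesis charE : p \in [pchar E].

Let p_gt0 : (0 < p)%N. Proof. exact/prime_gt0/(pcharf_prime charE). Qed.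
Let p_gt1 : (1 < p)%N. Proof. exact/prime_gt1/(pcharf_prime charE). Qed.

Lemma frob_sum (I : Type) (r : seq I) (P : pred I) (F : I -> E) n :
  (\sum_(i <- r | P i) F i) ^+ (p ^ n) = \sum_(i <- r | P i) F i ^+ (p ^ n).
Proof.
elim: n F => [|n IH] F.
  by rewrite expn0 expr1; apply: eq_bigr => i _; rewrite expr1.
rewrite expnSr exprM IH -(pFrobenius_autE charE) rmorph_sum.
by apply: eq_bigr => i _; rewrite /= pFrobenius_autE -exprM.
Qed.

Lemma frob1_sum (I : Type) (r : seq I) (P : pred I) (F : I -> E) :
  (\sum_(i <- r | P i) F i) ^+ p = \sum_(i <- r | P i) F i ^+ p.
Proof.
have := frob_sum r P F 1; rewrite expn1 => ->.
by apply: eq_bigr.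
Qed.

(** The exponent that [lam] accumulates when a relation [om = lam A om^p] is iterated [i] times. *)
Definition geom_sum i := (\sum_(k < i) p ^ k)%N.

Lemma geom_sum_inj : injective geom_sum.
Proof.
have lt m n : (m < n)%N -> (geom_sum m < geom_sum n)%N.
  elim: n => // n IH; rewrite ltnS leq_eqVlt => /predU1P [->|/IH lt].
    by rewrite /geom_sum big_ord_recr /= -addn1 leq_add2l expn_gt0 p_gt0.
  by apply: (leq_trans lt); rewrite /geom_sum big_ord_recr /= leq_addr.
move=> m n eq_mn; case: (ltngtP m n) => // /lt; rewrite eq_mn ltnn //.
Qed.

Section SelfSimilar.
Variables (S L : set E) (I : finType) (om : I -> E) (lam : E).
Hypotheses (hS : is_subring S) (hL : alg_closed_in L).
Hypothesis SL : forall x, S x -> L x.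
Hypothesis om_span : forall f, in_span S (fun g => lam * om g ^+ p) (om f).

Let y i f := lam ^+ geom_sum i * om f ^+ (p ^ i).

(** Raising the relation to the power [p ^ i] puts each iterate [y i] in the span of [y i.+1]. Hence
    all iterates up to [#|I|] lie in the span of the [#|I|] entries of the last one, and there are
    [#|I|.+1] of them. *)
Lemma self_similar_dependent f :
  dependent S (fun i : 'I_(#|I|.+1) => y i f).
Proof.
have step i g : in_span S (y i.+1) (y i g).
  have [c Sc omE] := om_span g.
  exists (fun h => c h ^+ (p ^ i)); first by move=> h; apply: subringX.
  rewrite /y {1}omE frob_sum big_distrr; apply: eq_bigr => h _ /=.
  rewrite !exprMn -!exprM -expnS [LHS]mulrCA; congr (_ * _).
  by rewrite mulrA -exprD /geom_sum big_ord_recr.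
have many i n g : in_span S (y (i + n)%N) (y i g).
  elim: n g => [|n IH] g; first by rewrite addn0; apply: in_span_gen.
  by rewrite addnS; apply: in_span_trans (IH g) _.
apply: (@dependent_span _ S I _ (y #|I|)) => //; first by rewrite card_ord.
by move=> i; have := many i (#|I| - i)%N f; rewrite subnKC // -ltnS ltn_ord.
Qed.

(** Where [om] equals 1 the dependence relation is a polynomial equation for [lam] alone, with the
    distinct exponents [geom_sum i]. *)
Lemma self_similar_scalar f0 : om f0 = 1 -> L lam.
Proof.
move=> om1; have [c [Sc ci cy]] := self_similar_dependent f0.
apply: (@alg_closed_sparse _ _ hL _ (fun i : 'I_ #|I|.+1 => geom_sum i) c) => //.
- by move=> i j /geom_sum_inj /val_inj.
- by move=> i; apply: SL.
by rewrite -[RHS]cy; apply: eq_bigr => i _; rewrite /y om1 expr1n mulr1.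
Qed.

(** Now the powers of [lam] count as coefficients, and the same relation is an equation for [om f]
    with exponents [p ^ i]. *)
Lemma self_similar_algebraic f : lam != 0 -> L lam -> L (om f).
Proof.
move=> lam0 Llam; have [c [Sc [i ci] cy]] := self_similar_dependent f.
apply: (@alg_closed_sparse _ _ hL _ (fun i : 'I_ #|I|.+1 => p ^ i)%N
  (fun i => c i * lam ^+ geom_sum i)).
- by move=> j k /eqP; rewrite eqn_exp2l // => /eqP /val_inj.
- move=> j; case: (hL) => hS' _.
  by apply: subringM => //; [apply: SL | apply: subringX].
- by exists i; rewrite mulf_neq0 // expf_neq0.
by rewrite -[RHS]cy; apply: eq_bigr => j _; rewrite /y mulrA.
Qed.

End SelfSimilar.

(* Passing to maximal minors turns the matrix [G] into the scalar [\det G], so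
   that the vector of minors is self-similar. *)
Lemma self_similar_coordinates (S L : set E) (D : finType) r
    (c : D -> 'I_r -> E) (G : 'M[E]_r) (delta : E) (A : D -> D -> E)
    (u : 'I_r -> D) :
  is_subring S -> alg_closed_in L -> (forall x, S x -> L x) ->
  L delta -> delta != 0 -> (forall k l, S (A k l)) ->
  (forall l m, delta * c l m = \sum_k A l k * \sum_i c k i ^+ p * G i m) ->
  (forall i j, c (u i) j = (i == j)%:R) ->
  forall l i, L (c l i).
Proof.
move=> hS hL SL Ldelta delta0 SA cE cu l i.
pose M (f : {ffun 'I_r -> D}) := \matrix_(i, j) c (f i) j : 'M[E]_r.
pose om f := \det (M f); pose lam := \det G / delta ^+ r.
have om_span f : in_span S (fun g => lam * om g ^+ p) (om f).
  exists (fun g : {ffun _ -> _} => \prod_i A (f i) (g i)).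
    by move=> g; apply: subring_prod.
  have dr0 : delta ^+ r != 0 by rewrite expf_neq0.
  apply: (mulfI dr0); rewrite -detZ.
  have -> : delta *: M f =
      (\matrix_(i, j) \sum_k A (f i) k * c k j ^+ p) *m G.
    apply/matrixP => j m; rewrite !mxE cE.
    under [RHS]eq_bigr do rewrite mxE big_distrl /=.
    rewrite exchange_big; apply: eq_bigr => k _ /=.
    by rewrite big_distrr; apply: eq_bigr => h _ /=; rewrite mulrA.
  rewrite det_mulmx.
  (* Multilinear expansion along the rows, over all maps [g] and not just increasing ones: repeated
     rows give zero minors. Frobenius commutes with the determinant. *)
  have -> : \det (\matrix_(i, j) \sum_k A (f i) k * c k j ^+ p) =
     \sum_(g : {ffun 'I_r -> D}) (\prod_i A (f i) (g i)) * om g ^+ p.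
    rewrite /determinant.
    under eq_bigr => s _.
      under eq_bigr => j _ do rewrite mxE.
      rewrite bigA_distr_bigA big_distrr /=.
    over.
    rewrite exchange_big; apply: eq_bigr => g _ /=.
    rewrite -(pFrobenius_autE charE) /om -det_map_mx /determinant big_distrr.
    apply: eq_bigr => s _ /=; rewrite big_split /= mulrCA; congr (_ * (_ * _)).
    by apply: eq_bigr => j _; rewrite !mxE pFrobenius_autE.
  rewrite mulrC !big_distrr /=; apply: eq_bigr => g _.
  rewrite [RHS]mulrCA [LHS]mulrCA; congr (_ * _).
  by rewrite mulrA /lam mulrCA divff // mulr1.
pose f0 := [ffun i => u i].
have om1 : om f0 = 1.
  rewrite /om; have -> : M f0 = 1%:M by apply/matrixP => j k; rewrite !mxE ffunE.
  exact: det1.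
have Llam := self_similar_scalar hS hL SL om_span om1.
have lam0 : lam != 0.
  apply/eqP => lam0; have [a _] := om_span f0; rewrite om1 => /eqP.
  rewrite big1 ?oner_eq0 // => g _; rewrite lam0 mul0r mulr0 //.
(* Putting row [l] in place of row [i] of the identity matrix gives a minor equal to the entry
   [c l i]. *)
have := self_similar_algebraic hS hL SL om_span
  [ffun j => if j == i then l else u j] lam0 Llam.
rewrite /om (expand_det_col _ i) (bigD1 i) //= big1 => [|j ji]; last first.
  by rewrite mxE ffunE (negPf ji) cu (negPf ji) mul0r.
rewrite addr0 mxE ffunE eqxx /cofactor addnn -signr_odd odd_double mul1r.
set N := row' _ _; have -> : N = 1%:M.
  apply/matrixP => j k; rewrite !mxE ffunE eq_sym (negPf (neq_lift _ _)) cu.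
  by rewrite (inj_eq lift_inj).
by rewrite det1 mulr1.
Qed.

(** The powers of [pi] below [p] are independent over the field of [p]-th powers. A relation makes
    [Q] share a factor with [X^p - pi]. Frobenius on coefficients turns this factor into
    [(X - pi)^m] with [0 < m < p], up to a scalar, so [pi ^+ m] is a [p]-th power, and so is [pi]
    because [m] is prime to [p]. *)
Lemma frob_power_independent (pi : E) (y : nat -> E) :
  (forall z, z ^+ p != pi) ->
  \sum_(a < p) pi ^+ a * y a ^+ p = 0 -> forall a, (a < p)%N -> y a = 0.
Proof.
move=> npi sum0.
pose Q := \poly_(a < p) y a; pose F := pFrobenius_aut charE.
suff Q0 : Q = 0.
  by move=> a lta; have := coef_poly p y a; rewrite lta => <-; rewrite -/Q Q0 coef0.
apply/eqP; apply: contraT => Q0.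
pose g := gcdp Q ('X^p - pi%:P).
have gF : map_poly F g %= gcdp (map_poly F Q) (('X - pi%:P) ^+ p).
  have -> : ('X - pi%:P) ^+ p = map_poly F ('X^p - pi%:P).
    rewrite rmorphB /= map_polyXn map_polyC /= pFrobenius_autE.
    have charP : p \in [pchar {poly E}] by rewrite pchar_poly.
    rewrite -(pFrobenius_autE charP) rmorphB /= !pFrobenius_autE.
    by rewrite polyC_exp.
  by rewrite gcdp_map eqpxx.
have : map_poly F g %| ('X - pi%:P) ^+ p.
  by rewrite (eqp_dvdl _ gF) dvdp_gcdr.
case/dvdp_exp_XsubCP => m _ gm.
have Qpi : root (map_poly F Q) pi.
  rewrite /root (@horner_coef_wide _ p); last first.
    by rewrite size_map_poly size_poly.
  apply/eqP; rewrite -[RHS]sum0; apply: eq_bigr => a _.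
  by rewrite coef_map coef_poly ltn_ord /= pFrobenius_autE mulrC.
have m_gt0 : (0 < m)%N.
  rewrite lt0n; apply/eqP => m0; move: gm; rewrite m0 expr0.
  rewrite (eqp_ltrans gF) => /eqp_root /(_ pi); rewrite root_gcd Qpi.
  have -> : root (('X - pi%:P) ^+ p) pi.
    by rewrite /root horner_exp hornerXsubC subrr expr0n eqn0Ngt p_gt0.
  by rewrite (negPf (root1 _)).
have m_lt : (m < p)%N.
  have := eqp_size gm; rewrite size_map_poly size_exp_XsubC => <-.
  by apply: leq_trans (size_poly p y); apply: dvdp_leq => //; apply: dvdp_gcdl.
have [[c1 c2] /= /andP[c10 c20] cE] := eqpP _ _ gm.
(* The coefficients of [map_poly F g] are [p]-th powers; the quotient of its constant and leading
   coefficients is [(- pi) ^+ m]. *)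
have pm : exists z, z ^+ p = pi ^+ m.
  have := congr1 lead_coef cE; have := congr1 (horner^~ 0) cE.
  rewrite !lead_coefZ !hornerZ lead_coef_map (monicP (monic_exp _ _)) ?monicXsubC //.
  rewrite horner_exp !hornerE.
  rewrite -[X in (map_poly F g).[X]](rmorph0 F) horner_map /= => h1 h2.
  have h : (- pi) ^+ m = (g.[0] / lead_coef g) ^+ p.
    rewrite expr_div_n; apply: (mulfI c20).
    have {h1} <- : c1 * g.[0] ^+ p = c2 * (- pi) ^+ m.
      by rewrite -[RHS]h1 /F /= pFrobenius_autE.
    have {h2} h2 : c1 * lead_coef g ^+ p = c2 by rewrite -[RHS]h2.
    have g0 : lead_coef g ^+ p != 0.
      by apply: contraNneq c20 => g0; rewrite -h2 g0 mulr0.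
    by rewrite -h2 mulrACA divff // mulr1.
  rewrite exprNn in h.
  have sgp : ((-1) ^+ m) ^+ p = (-1) ^+ m :> E.
    by rewrite -exprM mulnC exprM -(pFrobenius_autE charE) rmorphN1.
  exists ((-1) ^+ m * (g.[0] / lead_coef g)).
  by rewrite exprMn -h sgp mulrA -expr2 sqrr_sign mul1r.
(* Bezout: [km * m = kn * p + 1], so [z ^+ km / pi ^+ kn] is a [p]-th root of [pi]. *)
case: (egcdnP p m_gt0) => km kn kE _.
have [z zE] := pm.
have cop : gcdn m p = 1%N.
  apply/eqP; rewrite -/(coprime m p) coprime_sym prime_coprime ?(pcharf_prime charE) //.
  by rewrite gtnNdvd.
have pi0 : pi != 0.
  by apply: contraNneq (npi 0) => ->; rewrite expr0n eqn0Ngt p_gt0.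
have := npi (z ^+ km / pi ^+ kn); rewrite expr_div_n -!exprM.
rewrite [(km * p)%N]mulnC exprM zE -exprM [(m * km)%N]mulnC kE cop exprD.
by rewrite mulrC mulrA mulVf ?expf_neq0 // mul1r expr1 eqxx.
Qed.

End Frobenius.

(** * Algebraic relations over a function field *)

Section PolyImage.
Variables (k E : fieldType) (j : {rmorphism k -> E}).
Implicit Types (t x z : E) (P Q : {poly k}).

Definition ev t : {poly k} -> E := horner_morph (fun c => mulrC t (j c)).

HB.instance Definition _ t := GRing.RMorphism.on (ev t).

Lemma evE t P : ev t P = (map_poly j P).[t].
Proof. by []. Qed.

Lemma evX t : ev t 'X = t.
Proof. by rewrite evE map_polyX hornerX. Qed.

Lemma evC t c : ev t c%:P = j c.
Proof. by rewrite evE map_polyC hornerC. Qed.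

Lemma ev_wide n t P : (size P <= n)%N -> ev t P = \sum_(i < n) j P`_i * t ^+ i.
Proof.
move=> leP; rewrite evE (@horner_coef_wide _ n) ?size_map_poly //.
by apply: eq_bigr => i _; rewrite coef_map.
Qed.

Lemma ev_poly n t (c : nat -> k) :
  ev t (\poly_(i < n) c i) = \sum_(i < n) j (c i) * t ^+ i.
Proof.
rewrite (ev_wide t (size_poly n c)).
by apply: eq_bigr => i _; rewrite coef_poly ltn_ord.
Qed.

Definition poly_image t : set E := [set y | exists P, y = ev t P].

Lemma poly_image_subring t : is_subring (poly_image t).
Proof.
split.
- by exists 1; rewrite rmorph1.
- by move=> _ _ [P ->] [Q ->]; exists (P - Q); rewrite rmorphB.
by move=> _ _ [P ->] [Q ->]; exists (P * Q); rewrite rmorphM.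
Qed.
Hint Resolve poly_image_subring : core.

Lemma poly_imageP t P : poly_image t (ev t P).
Proof. by exists P. Qed.

Lemma poly_imageC t c : poly_image t (j c).
Proof. by exists c%:P; rewrite evC. Qed.

Lemma poly_image_closed t L : alg_closed_in L -> (forall c, L (j c)) -> L t ->
  forall y, poly_image t y -> L y.
Proof.
move=> [hS _] Lj Lt _ [P ->]; rewrite (ev_wide _ (leqnn _)).
by apply: subring_sum => // i _; apply: subringM => //; apply: subringX.
Qed.

Definition transcendental t := forall P, ev t P = 0 -> P = 0.

Lemma dependent_polys t (I : finType) (y : I -> E) :
  dependent (poly_image t) y ->
  exists b : I -> {poly k}, (exists i, b i != 0) /\ \sum_i ev t (b i) * y i = 0.
Proof.
case=> c [/fin_all_exists [b bE] [i ci] cy].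
exists b; split; last by rewrite -[RHS]cy; apply: eq_bigr => l _; rewrite bE.
by exists i; apply: contraNneq ci; rewrite bE => ->; rewrite rmorph0.
Qed.

(** A relation is a polynomial in two variables and can be sorted by powers of [x] instead of [t].
    Transcendence of [t] keeps a nonzero coefficient nonzero after evaluation. *)
Lemma dependent_powers_swap x t m : transcendental t ->
  dependent (poly_image x) (fun i : 'I_m => t ^+ i) ->
  exists n, dependent (poly_image t) (fun i : 'I_n => x ^+ i).
Proof.
move=> trt /dependent_polys [b [[i0 bi0] bt]].
pose n := \max_i size (b i).
have leb i : (size (b i) <= n)%N by rewrite /n (leq_bigmax i).
pose a (l : nat) := \sum_i (b i)`_l *: 'X^i.
have aE l : ev t (a l) = \sum_i j (b i)`_l * t ^+ i.
  rewrite rmorph_sum; apply: eq_bigr => i _ /=.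
  by rewrite -mul_polyC rmorphM /= evC rmorphXn /= evX.
exists n, (fun l : 'I_n => ev t (a l)); split.
- by move=> l; apply: poly_imageP.
- have lt : ((size (b i0)).-1 < n)%N.
    by apply: leq_trans (leb i0); rewrite ltn_predL lt0n size_poly_eq0.
  exists (Ordinal lt); apply: contraNneq bi0 => /trt.
  move=> /(congr1 (fun q : {poly k} => q`_i0)).
  rewrite coef0 coef_sum (bigD1 i0) //= coefZ coefXn eqxx mulr1 big1.
    by move/eqP; rewrite addr0 -lead_coefE lead_coef_eq0.
  move=> i ne; rewrite coefZ coefXn; case: eqP => [/val_inj ei|_].
    by rewrite ei eqxx in ne.
  by rewrite mulr0.
rewrite -[RHS]bt.
under eq_bigr => l _ do rewrite aE big_distrl /=.
rewrite exchange_big; apply: eq_bigr => i _ /=.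
rewrite (ev_wide _ (leb i)) big_distrl; apply: eq_bigr => l _ /=.
by rewrite mulrAC.
Qed.

(** Since [x] is integral over [k[t]] up to the denominator [a], products of low powers of [x] with
    the old generators suffice; [a ^+ s] clears all denominators, [s] bounding the degrees in
    [x]. *)
Lemma finite_over_change x t (V : set E) m (I : finType) (g : I -> E) :
  dependent (poly_image t) (fun i : 'I_m => x ^+ i) ->
  finite_over (poly_image x) V g ->
  exists (J : finType) (h : J -> E), finite_over (poly_image t) V h.
Proof.
move=> /dependent_powers [] // d [a [Sa a0 ax]] fV.
exists ('I_d * I)%type, (fun bl : 'I_d * I => x ^+ bl.1 * g bl.2) => T y Vy.
have [u u0 uy] := fV T y Vy.
have [P uyP] : exists P : T -> I -> {poly k},
    forall i, u * y i = \sum_l ev x (P i l) * g l.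
  suff: forall i, exists P : I -> {poly k}, u * y i = \sum_l ev x (P l) * g l.
    by move/fin_all_exists.
  move=> i; have [c /fin_all_exists [P cP] ->] := uy i.
  by exists P; apply: eq_bigr => l _; rewrite cP.
pose s := \max_(il : T * I) size (P il.1 il.2).
have les i l : (size (P i l) <= s)%N by rewrite /s (leq_bigmax (i, l)).
exists (a ^+ s * u) => [|i]; first by rewrite mulf_neq0 // expf_neq0.
rewrite -mulrA uyP big_distrr; apply: in_span_sum => // l _ /=.
rewrite (ev_wide _ (les i l)) big_distrl big_distrr; apply: in_span_sum => // e _ /=.
have -> : a ^+ s * (j (P i l)`_e * x ^+ e * g l) =
    (j (P i l)`_e * a ^+ (s - e)) * ((a ^+ e * x ^+ e) * g l).
  have {1}-> : s = (s - e + e)%N by rewrite subnK // ltnW.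
  rewrite exprD; move: (a ^+ _) (a ^+ _) (j _) (x ^+ _) => a1 a2 j1 x1.
  by ring.
apply: in_spanZ => //.
  by apply: subringM => //; [apply: poly_imageC | apply: subringX].
have [c Sc ->] := in_span_powers e (poly_image_subring t) Sa a0 ax.
rewrite big_distrl; apply: in_span_sum => // b _ /=; rewrite -mulrA.
apply: in_spanZ => //.
exact: (@in_span_gen _ _ _ (fun bl : 'I_d * I => x ^+ bl.1 * g bl.2) (b, l)).
Qed.

(** Reduction modulo an equation [P] of [z] leaves only finitely many coefficients in [K], for which
    a common denominator exists. *)
Lemma finite_over_adjoin (K : fieldType) (iota : {rmorphism K -> E})
    (S : set E) (I : finType) (g : I -> E) z :
  is_subring S -> finite_over S (range iota) g -> algebraicOver iota z ->
  exists (J : finType) (h : J -> E),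
    finite_over S [set y | exists Q : {poly K}, y = (map_poly iota Q).[z]] h.
Proof.
move=> hS fK [P P0 Pz]; pose d := size P.
exists ('I_d * I)%type, (fun bl : 'I_d * I => z ^+ bl.1 * g bl.2) => T y.
move=> /fin_all_exists [Q yQ].
pose c (tb : T * 'I_d) := iota (Q tb.1 %% P)`_tb.2.
have [|u u0 uc] := fK _ c; first by move=> tb; exists (Q tb.1 %% P)`_tb.2.
exists u => // i; rewrite yQ (divp_eq (Q i) P) rmorphD rmorphM /= hornerD hornerM.
rewrite (rootP Pz) mulr0 add0r (@horner_coef_wide _ d); last first.
  by rewrite size_map_poly ltnW // ltn_modp.
rewrite big_distrr; apply: in_span_sum => // b _ /=.
rewrite coef_map mulrA; have [e Se /= ->] := uc (i, b).
rewrite big_distrl; apply: in_span_sum => // l _ /=.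
rewrite -mulrA; apply: in_spanZ => //; rewrite mulrC.
exact: (@in_span_gen _ _ _ (fun bl : 'I_d * I => z ^+ bl.1 * g bl.2) (b, l)).
Qed.

End PolyImage.
#[global] Hint Resolve poly_image_subring : core.

Section FunctionField.
Variables (k K E : fieldType) (f : {rmorphism k -> K}).
Variables (iota : {rmorphism K -> E}).
Local Notation j := (iota \o f).

Lemma finite_over_base x : finite_degree_over (simple_ext f x) ->
  exists d (g : 'I_d -> E), finite_over (poly_image j (iota x)) (range iota) g.
Proof.
case=> d [e Ke]; exists d, (iota \o e) => T y Vy.
have jE P : ev j (iota x) P = iota (map_poly f P).[x].
  by rewrite evE map_poly_comp horner_map.
have [c yc] : exists c : T -> 'I_d -> {poly k} * {poly k},
    (forall i l, (map_poly f (c i l).2).[x] != 0) /\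
    forall i, y i = iota (\sum_l (map_poly f (c i l).1).[x] /
                                 (map_poly f (c i l).2).[x] * e l).
  suff: forall i, exists c : 'I_d -> {poly k} * {poly k},
      (forall l, (map_poly f (c l).2).[x] != 0) /\
      y i = iota (\sum_l (map_poly f (c l).1).[x] /
                         (map_poly f (c l).2).[x] * e l).
    case/fin_all_exists => c cP; exists c.
    by split=> i; [case: (cP i) | case: (cP i) => _ ->].
  move=> i; have [z _ <-] := Vy i; have [a Fa ->] := Ke z.
  have {Fa} /fin_all_exists [c cP] : forall l, exists c : {poly k} * {poly k},
      (map_poly f c.2).[x] != 0 /\
      a l = (map_poly f c.1).[x] / (map_poly f c.2).[x].
    (* A quotient with vanishing denominator has value 0 and is rewritten as [0 / 1], so that all
       denominators can be multiplied together. *)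
    move=> l; have [P [Q ->]] := Fa l; have [Q0|Q0] := eqVneq (map_poly f Q).[x] 0.
      exists (0, 1); rewrite rmorph1 rmorph0 hornerC horner0 oner_neq0 Q0.
      by rewrite invr0 mulr0 mul0r.
    by exists (P, Q).
  exists c; split=> [l|]; first by case: (cP l).
  by congr (iota _); apply: eq_bigr => l _; case: (cP l) => _ <-.
case: yc => c0 yc.
pose q i l := ev j (iota x) (c i l).2.
have q0 i l : q i l != 0 by rewrite /q jE fmorph_eq0.
exists (\prod_i \prod_l q i l) => [|i].
  by apply/prodf_neq0 => i _; apply/prodf_neq0.
rewrite yc rmorph_sum big_distrr; apply: in_span_sum => // l _ /=.
rewrite (bigD1 i) //= (bigD1 l) //= rmorphM fmorph_div -!jE /= -/(q i l).
set u := \prod_(_ | _) _; set v := \prod_(_ | _) _.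
have -> : q i l * u * v * (ev j (iota x) (c i l).1 / q i l * iota (e l)) =
    (u * v * ev j (iota x) (c i l).1) * iota (e l).
  have h (a b c1 u1 v1 : E) : c1 != 0 ->
      c1 * u1 * v1 * (a / c1 * b) = u1 * v1 * a * b by move=> ?; field.
  exact: h.
apply: in_spanZ => //; last exact: (@in_span_gen _ _ _ (iota \o e) l).
apply: subringM => //; last exact: poly_imageP.
apply: subringM => //.
  by apply: subring_prod => // *; apply: poly_imageP.
by apply: subring_prod => // *; apply: subring_prod => // *; apply: poly_imageP.
Qed.

Variable x : K.
Hypothesis hx : finite_degree_over (simple_ext f x).

(** The powers of [t] are dependent over [k[x]] because [K[t]] is finite over it; swapping roles
    makes [x] algebraic over [k(t)], and the base can be changed from [x] to [t]. *)
Lemma finite_over_transcendental t :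
  algebraicOver iota t -> transcendental j t ->
  exists (J : finType) (h : J -> E),
    finite_over (poly_image j t) (range iota) h.
Proof.
move=> algt trt; have [d [g fK]] := finite_over_base hx.
have [|J [h fKt]] := finite_over_adjoin _ fK algt; first by [].
have dep : dependent (poly_image j (iota x)) (fun i : 'I_#|J|.+1 => t ^+ i).
  apply: (finite_over_dependent _ fKt) => //; last by rewrite card_ord.
  by move=> i; exists 'X^i; rewrite map_polyXn hornerXn.
have [n depx] := dependent_powers_swap trt dep.
exact: finite_over_change depx fK.
Qed.

(** All [z ^+ (p ^ i)] lie in [K[z]], which is finite over [k[t]] up to denominators, so
    sufficiently many of them are dependent. *)
Lemma algebraic_additive_relation p t z :
  algebraicOver iota t -> transcendental j t -> algebraicOver iota z ->
  exists n (b : 'I_n -> {poly k}),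
    (exists i, b i != 0) /\ \sum_(i < n) ev j t (b i) * z ^+ (p ^ i) = 0.
Proof.
move=> algt trt algz; have [I [g fK]] := finite_over_transcendental algt trt.
have [|J [h fKz]] := finite_over_adjoin _ fK algz; first by [].
exists #|J|.+1; apply: dependent_polys.
apply: (finite_over_dependent _ fKz) => //; last by rewrite card_ord.
by move=> i; exists 'X^(p ^ i); rewrite map_polyXn hornerXn.
Qed.

End FunctionField.

(** * Valuations and digits *)

Lemma sum_pair (V : nmodType) (I J : finType) (F : I * J -> V) :
  \sum_ij F ij = \sum_i \sum_j F (i, j).
Proof. by rewrite pair_bigA; apply: eq_bigr => -[]. Qed.

Section Valuation.
Variables (E : fieldType) (w : E -> int).
Hypothesis hw : valuation w.
Implicit Types (x y z t : E) (m n : int).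

Local Notation vge := (val_ge w).

Lemma valuationM x y : x != 0 -> y != 0 -> w (x * y) = w x + w y.
Proof. by case: hw => h _; apply: h. Qed.

Lemma valuation1 : w 1 = 0.
Proof.
have := @valuationM 1 1 (oner_neq0 _) (oner_neq0 _); rewrite mulr1.
by move=> h; apply: (addrI (w 1)); rewrite -h addr0.
Qed.

Lemma valuationX x i : x != 0 -> w (x ^+ i) = i%:Z * w x.
Proof.
move=> x0; elim: i => [|i IH]; first by rewrite expr0 valuation1 mul0r.
by rewrite exprS valuationM ?expf_neq0 // IH intS mulrDl mul1r.
Qed.

Lemma valuationN x : w (- x) = w x.
Proof.
have [->|x0] := eqVneq x 0; first by rewrite oppr0.
have wN1 : w (-1) = 0.
  have N10 : -1 != 0 :> E by rewrite oppr_eq0 oner_eq0.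
  have := valuationX 2 N10; rewrite sqrrN expr1n valuation1 => /esym/eqP.
  by rewrite mulf_eq0 => /orP [|/eqP].
by rewrite -mulN1r valuationM ?wN1 ?add0r // oppr_eq0 oner_eq0.
Qed.

Lemma vge_0 n : vge n 0.
Proof. by rewrite /val_ge eqxx. Qed.

Lemma vgeN n x : vge n (- x) = vge n x.
Proof. by rewrite /val_ge oppr_eq0 valuationN. Qed.

Lemma vgeD n x y : vge n x -> vge n y -> vge n (x + y).
Proof.
rewrite /val_ge; have [->|x0] := eqVneq x 0; first by rewrite add0r.
have [->|y0] := eqVneq y 0; first by rewrite addr0 (negPf x0).
have [//|xy0] := eqVneq (x + y) 0; rewrite /= => nx ny.
by case: hw => _ /(_ x y x0 y0 xy0); apply: le_trans; rewrite le_min nx.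
Qed.

Lemma vgeB n x y : vge n x -> vge n y -> vge n (x - y).
Proof. by move=> nx ny; apply: vgeD; rewrite ?vgeN. Qed.

Lemma vge_le m n x : m <= n -> vge n x -> vge m x.
Proof.
by rewrite /val_ge => le /orP [->//|h]; rewrite (le_trans le h) orbT.
Qed.

Lemma vgeM m n x y : vge m x -> vge n y -> vge (m + n) (x * y).
Proof.
rewrite /val_ge mulf_eq0; have [//|x0] := eqVneq x 0.
have [//|y0] := eqVneq y 0; rewrite /= => mx ny.
by rewrite valuationM // lerD.
Qed.

Lemma vgeX (q : nat) n x : vge n x -> vge (q%:Z * n) (x ^+ q).
Proof.
move=> nx; elim: q => [|q IH].
  by rewrite mul0r expr0 /val_ge valuation1 lexx orbT.
by rewrite exprS intS mulrDl mul1r; apply: vgeM.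
Qed.

Lemma vge_mull t n x : t != 0 -> vge (w t + n) (t * x) = vge n x.
Proof.
move=> t0; rewrite /val_ge mulf_eq0 (negPf t0) /=.
by have [//|x0] := eqVneq x 0; rewrite valuationM // lerD2l.
Qed.

Lemma vge_sum n (I : Type) (r : seq I) (P : pred I) (F : I -> E) :
  (forall i, P i -> vge n (F i)) -> vge n (\sum_(i <- r | P i) F i).
Proof.
move=> nF; elim/big_ind: _ => //; first exact: vge_0.
by move=> x y; apply: vgeD.
Qed.

Lemma vge_eq0 t x : 0 < w t -> (forall i : nat, vge (i%:Z * w t) x) -> x = 0.
Proof.
move=> wt H; apply/eqP; apply: contraT => x0.
have := H `|w x|%N.+1; rewrite /val_ge (negPf x0) /=.
rewrite leNgt => /negP []; apply: (@lt_le_trans _ _ (`|w x|%N.+1%:Z)).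
  by apply: le_lt_trans (ler_norm _) _; rewrite -abszE ltz_nat.
by rewrite ler_peMr // gtz0_ge1.
Qed.

Lemma val_ring_subring : is_subring (val_ring w).
Proof.
split; first by rewrite /val_ring /= /val_ge valuation1 lexx orbT.
  by move=> x y; apply: vgeB.
by move=> x y Ax Ay; have := vgeM Ax Ay; rewrite addr0.
Qed.

Lemma val_ring_mul t x : 0 <= w t -> val_ring w x -> vge (w t) (t * x).
Proof.
move=> wt Ax; have := @vgeM (w t) 0 t x _ Ax; rewrite addr0; apply.
by rewrite /val_ge lexx orbT.
Qed.

Lemma vge_divl t n x : t != 0 -> vge n (x / t) = vge (w t + n) x.
Proof. by move=> t0; rewrite -(vge_mull _ _ t0) mulrC divfK. Qed.

Section PrimeDigits.
Variables (p : nat) (j : {rmorphism 'F_p -> E}).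

Lemma val_ring_prime c : val_ring w (j c).
Proof.
rewrite -(natr_Zp c) rmorph_nat; elim: (c : nat) => [|n IH]; first exact: vge_0.
by rewrite mulrS; apply: vgeD => //; case: val_ring_subring.
Qed.

Lemma val_prime c : c != 0 -> w (j c) = 0.
Proof.
move=> c0; have jc0 : j c != 0 by rewrite fmorph_eq0.
have := val_ring_prime c; have := val_ring_prime c^-1.
rewrite fmorphV /val_ring /= /val_ge invr_eq0 (negPf jc0) /= => h1 h2.
apply/eqP; rewrite eq_le h2 andbT.
have := valuationM jc0 (_ : (j c)^-1 != 0).
rewrite invr_eq0 divff // valuation1 => /(_ jc0).
by move/esym/eqP; rewrite addr_eq0 => /eqP ->; rewrite oppr_le0.
Qed.

Lemma prime_digit_eq0 t c : 0 < w t -> vge (w t) (j c) -> c = 0.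
Proof.
move=> wt; rewrite /val_ge fmorph_eq0 => /orP [/eqP //|h].
apply/eqP; apply: contraT => c0; move: h.
by rewrite val_prime // leNgt wt.
Qed.

Definition independent_mod t (I : finType) (g : I -> E) :=
  forall c : I -> 'F_p, vge (w t) (\sum_i j (c i) * g i) -> forall i, c i = 0.

Definition spanning_mod t (I : finType) (g : I -> E) :=
  forall x, val_ring w x ->
    exists c : I -> 'F_p, vge (w t) (x - \sum_i j (c i) * g i).

(** Modulo [t] only the block without [t] survives, so its coefficients vanish; the rest is divided
    by [t] and treated in the same way. *)
Lemma independent_mod_powers t (n : nat) (I : finType) (g : I -> E) :
  t != 0 -> 0 < w t -> (forall i, val_ring w (g i)) -> independent_mod t g ->
  independent_mod (t ^+ n) (fun bi : 'I_n * I => t ^+ bi.1 * g bi.2).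
Proof.
move=> t0 wt Ag ind; elim: n => [|n IH] c hc [b i]; first by case: b.
pose c0 i := c (ord0, i); pose c1 bi := c (lift ord0 bi.1, bi.2).
pose s0 := \sum_i j (c0 i) * g i.
pose s1 := \sum_(bi : 'I_n * I) j (c1 bi) * (t ^+ bi.1 * g bi.2).
have sE : \sum_bi j (c bi) * (t ^+ bi.1 * g bi.2) = s0 + t * s1.
  rewrite sum_pair big_ord_recl /=; congr (_ + _).
    by apply: eq_bigr => l _; rewrite expr0 mul1r.
  rewrite /s1 sum_pair.
  rewrite big_distrr; apply: eq_bigr => b' _; rewrite big_distrr.
  by apply: eq_bigr => l _; rewrite /c1 /= /bump /= add1n exprS -!mulrA mulrCA.
have As1 : val_ring w s1.
  apply: subring_sum => [|bi _]; first exact: val_ring_subring.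
  apply: subringM; [exact: val_ring_subring|exact: val_ring_prime|].
  apply: subringM => //; first exact: val_ring_subring.
  apply: subringX; first exact: val_ring_subring.
  by rewrite /val_ring /= /val_ge ltW // orbT.
move: hc; rewrite sE valuationX // intS mulrDl mul1r => hc.
have c00 : forall i, c0 i = 0.
  apply: ind; rewrite -/s0 -[s0](addrK (t * s1)); apply: vgeB.
    by apply: vge_le hc; rewrite lerDl mulr_ge0 // ltW.
  by apply: val_ring_mul => //; apply: ltW.
have s00 : s0 = 0 by rewrite /s0 big1 // => l _; rewrite c00 rmorph0 mul0r.
have c10 : forall bi, c1 bi = 0.
  by apply: IH; rewrite valuationX // -(vge_mull _ _ t0) -/s1 -[t * s1]add0r -s00.
case: (unliftP ord0 b) => [b' ->|->]; first exact: (c10 (b', i)).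
exact: c00.
Qed.

Section Base.
Variable t : E.
Hypotheses (t0 : t != 0) (wt : 0 < w t).

Let wt' : 0 <= w t. Proof. exact: ltW. Qed.
Let At : val_ring w t. Proof. by rewrite /val_ring /= /val_ge wt' orbT. Qed.
Let hA := val_ring_subring.

Lemma val_ring_ev P : val_ring w (ev j t P).
Proof.
rewrite (ev_wide _ _ (leqnn _)); apply: subring_sum => // i _.
by apply: subringM => //; [apply: val_ring_prime | apply: subringX].
Qed.

Lemma vge_tX (n : nat) x : val_ring w x -> vge (n%:Z * w t) (t ^+ n * x).
Proof.
move=> Ax; rewrite -valuationX //; apply: val_ring_mul => //.
by rewrite valuationX // mulr_ge0.
Qed.

Definition digit_sum (c : nat -> 'F_p) (n : nat) := \sum_(k < n) j (c k) * t ^+ k.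

Definition has_digits (c : nat -> 'F_p) z :=
  forall n : nat, vge (n%:Z * w t) (z - digit_sum c n).

(* The closure of [F_p[t]], that is, the image of [F_p[[t]]]. *)
Definition series_ring : set E :=
  [set z | forall n : nat, exists P, vge (n%:Z * w t) (z - ev j t P)].

Lemma digit_sum_shift c (n : nat) :
  digit_sum c n.+1 = j (c 0%N) + t * digit_sum (fun k => c k.+1) n.
Proof.
rewrite /digit_sum big_ord_recl expr0 mulr1 big_distrr; congr (_ + _).
by apply: eq_bigr => k _; rewrite /= /bump /= add1n exprS mulrCA.
Qed.

Lemma has_digits_series c z : has_digits c z -> series_ring z.
Proof.
move=> H n; exists (\poly_(i < n) c i).
by rewrite ev_poly; apply: H.
Qed.

Lemma series_val_ring z : series_ring z -> val_ring w z.
Proof.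
move=> /(_ 0%N) [P]; rewrite mul0r => h; rewrite -(subrK (ev j t P) z).
by apply: vgeD => //; apply: val_ring_ev.
Qed.

Lemma series_subring : is_subring series_ring.
Proof.
split.
- by move=> n; exists 1; rewrite rmorph1 subrr vge_0.
- move=> x y Ox Oy n; have [P hP] := Ox n; have [Q hQ] := Oy n.
  exists (P - Q); rewrite rmorphB.
  have -> : x - y - (ev j t P - ev j t Q) = (x - ev j t P) - (y - ev j t Q) by ring.
  exact: vgeB.
move=> x y Ox Oy n; have [P hP] := Ox n; have [Q hQ] := Oy n.
exists (P * Q); rewrite rmorphM.
have -> : x * y - ev j t P * ev j t Q =
    (x - ev j t P) * y + ev j t P * (y - ev j t Q) by ring.
apply: vgeD.
  by rewrite -[_ * w t]addr0; apply: vgeM => //; apply: series_val_ring.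
by rewrite -[_ * w t]add0r; apply: vgeM => //; apply: val_ring_ev.
Qed.

Lemma poly_image_series y : poly_image j t y -> series_ring y.
Proof. by case=> P -> n; exists P; rewrite subrr vge_0. Qed.

(** The approximations to different precisions are unrelated polynomials, but their constant terms
    agree: a constant divisible by [t] is zero. *)
Lemma series_step z : series_ring z ->
  exists c z', series_ring z' /\ z = j c + t * z'.
Proof.
move=> Oz.
have [c cP] : exists c, forall n : nat, exists P,
    vge (n.+1%:Z * w t) (z - j c - t * ev j t P).
  have step (n : nat) : exists c P, vge (n.+1%:Z * w t) (z - j c - t * ev j t P).
    have [Q hQ] := Oz n.+1; exists (Q`_0), (drop_poly 1 Q).
    have QE : Q = (Q`_0)%:P + 'X * drop_poly 1 Q.
      rewrite -{1}(poly_take_drop 1 Q) expr1 mulrC; congr (_ + _).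
      by apply/polyP => -[|i]; rewrite coef_take_poly coefC.
    have QE' : ev j t Q = j Q`_0 + t * ev j t (drop_poly 1 Q).
      by rewrite {1}QE rmorphD rmorphM /= evC evX.
    by rewrite -addrA -opprD -QE'.
  have [c [P0 h0]] := step 0%N; exists c => n.
  have [c' [P h]] := step n; exists P; suff -> : c = c' by [].
  apply/eqP; rewrite -subr_eq0; apply/eqP; apply: (@prime_digit_eq0 t) => //.
  rewrite rmorphB.
  have -> : j c - j c' =
      (z - j c' - t * ev j t P) - (z - j c - t * ev j t P0) +
      t * (ev j t P - ev j t P0).
    by ring.
  apply: vgeD; last by apply: val_ring_mul => //; apply: vgeB; apply: val_ring_ev.
  apply: vgeB; last by move: h0; rewrite mul1r.
  by apply: vge_le h; rewrite intS mulrDl mul1r lerDl mulr_ge0.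
exists c, ((z - j c) / t); split; last by rewrite mulrC divfK // addrC subrK.
move=> n; have [P hP] := cP n; exists P.
rewrite -(vge_mull _ _ t0) mulrBr [t * (_ / _)]mulrC divfK //.
by move: hP; rewrite intS mulrDl mul1r.
Qed.

Lemma series_digits z : series_ring z -> exists c, has_digits c z.
Proof.
move=> Oz.
have /choice [f fP] : forall z : E, exists cz : 'F_p * E,
    series_ring z -> series_ring cz.2 /\ z = j cz.1 + t * cz.2.
  move=> x; case: (pselect (series_ring x)) => [/series_step [c [z' h]]|h].
    by exists (c, z').
  by exists (0, 0).
pose zs (n : nat) := iter n (fun x => (f x).2) z.
exists (fun n : nat => (f (zs n)).1).
have Ozs (n : nat) : series_ring (zs n).
  by elim: n => //= n IH; case: (fP _ IH).
have zE (n : nat) : z = digit_sum (fun n : nat => (f (zs n)).1) n + t ^+ n * zs n.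
  elim: n => [|n IH]; first by rewrite /digit_sum big_ord0 add0r expr0 mul1r.
  rewrite {1}IH {1}(fP _ (Ozs n)).2 /digit_sum big_ord_recr /= -addrA; congr (_ + _).
  by rewrite mulrDr exprSr mulrA [j _ * _]mulrC.
move=> n; rewrite {1}(zE n) addrC addKr; apply: vge_tX.
exact: series_val_ring.
Qed.

Lemma has_digits_unique c z z' : has_digits c z -> has_digits c z' -> z = z'.
Proof.
move=> h h'; apply/eqP; rewrite -subr_eq0; apply/eqP; apply: (vge_eq0 wt) => n.
have -> : z - z' = (z - digit_sum c n) - (z' - digit_sum c n) by ring.
exact: vgeB.
Qed.

Lemma has_digits_step c z : has_digits c z ->
  has_digits (fun k => c k.+1) ((z - j (c 0%N)) / t).
Proof.
move=> h n; rewrite -(vge_mull _ _ t0) mulrBr [t * (_ / _)]mulrC divfK //.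
by have := h n.+1; rewrite digit_sum_shift opprD addrA intS mulrDl mul1r.
Qed.

Lemma digits_unique c c' z : has_digits c z -> has_digits c' z -> c = c'.
Proof.
have c0E a b x : has_digits a x -> has_digits b x -> a 0%N = b 0%N.
  move=> h h'; apply/eqP; rewrite -subr_eq0; apply/eqP.
  apply: (@prime_digit_eq0 t) => //.
  have := vgeB (h' 1%N) (h 1%N); rewrite /digit_sum !big_ord1 !expr0 !mulr1 mul1r.
  have -> : x - j (b 0%N) - (x - j (a 0%N)) = j (a 0%N) - j (b 0%N) by ring.
  by rewrite rmorphB.
move=> h h'; apply/funext => n; elim: n c c' z h h' => [|n IH] c c' z h h'.
  exact: c0E h h'.
have := has_digits_step h'; rewrite -(c0E _ _ _ h h') => h2.
exact: IH (has_digits_step h) h2.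
Qed.

(** Modulo [t] all constant digits vanish. Dividing by [t] gives a relation of the same kind, so
    each [z i] is divisible by every power of [t]. *)
Lemma series_independent (I : finType) (g z : I -> E) :
  (forall i, val_ring w (g i)) -> independent_mod t g ->
  (forall i, series_ring (z i)) -> \sum_i z i * g i = 0 -> forall i, z i = 0.
Proof.
move=> Ag ind Oz zg i.
have step (y : I -> E) : (forall i, series_ring (y i)) -> \sum_i y i * g i = 0 ->
    exists y' : I -> E, [/\ forall i, series_ring (y' i), \sum_i y' i * g i = 0
      & forall i, y i = t * y' i].
  move=> Oy yg.
  have /fin_all_exists [c /fin_all_exists [y' yP]] : forall i, exists c z',
    series_ring z' /\ y i = j c + t * z' by move=> l; apply: series_step.
  have yE : \sum_i j (c i) * g i + t * \sum_i y' i * g i = 0.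
    rewrite -[RHS]yg big_distrr -big_split; apply: eq_bigr => l _ /=.
    by case: (yP l) => _ ->; ring.
  have c0 : forall l, c l = 0.
    apply: ind; move/eqP: yE; rewrite addr_eq0 => /eqP ->; rewrite vgeN.
    apply: val_ring_mul => //; apply: subring_sum => // l _.
    by apply: subringM => //; apply: series_val_ring; case: (yP l).
  exists y'; split=> [l||l]; first by case: (yP l).
    have s0 : \sum_i j (c i) * g i = 0.
      by rewrite big1 // => l _; rewrite c0 rmorph0 mul0r.
    by apply: (mulfI t0); rewrite mulr0 -[RHS]yE s0 add0r.
  by case: (yP l) => _ ->; rewrite c0 rmorph0 add0r.
apply: (vge_eq0 wt) => n; elim: n z Oz zg i => [|n IH] z Oz zg i.
  by rewrite mul0r; apply: series_val_ring.
have [y [Oy yg zE]] := step z Oz zg.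
rewrite zE intS mulrDl mul1r vge_mull //; exact: IH.
Qed.

(** The monomials occurring in [P] are independent already modulo [t ^+ size P]. *)
Lemma transcendental_base : transcendental j t.
Proof.
have one_ind : independent_mod t (fun _ : 'I_1 => 1 : E).
  move=> c; rewrite big_ord1 mulr1 => /prime_digit_eq0 c0 i.
  by rewrite ord1; apply: c0.
move=> P evP.
have sumE : \sum_(bi : 'I_(size P) * 'I_1) j P`_bi.1 * (t ^+ bi.1 * 1) = 0.
  rewrite sum_pair -[RHS]evP (ev_wide _ _ (leqnn _)).
  by apply: eq_bigr => b _; rewrite big_ord1 mulr1.
have c0 := @independent_mod_powers t (size P) _ _ t0 wt _ one_ind
  (fun bi => P`_bi.1).
apply/polyP => b; rewrite coef0; have [lt|le] := ltnP b (size P).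
  by apply: (c0 _ _ (Ordinal lt, ord0)) => [_|]; [case: hA|rewrite sumE vge_0].
exact: nth_default.
Qed.

End Base.
End PrimeDigits.
End Valuation.

(** * Cartier operators *)

Lemma sum_mod (V : nmodType) n q (F : nat -> V) :
  \sum_(k < n * q) F k = \sum_(a < q) \sum_(l < n) F (l * q + a)%N.
Proof.
rewrite exchange_big /=; elim: n => [|n IH]; first by rewrite !big_ord0.
by rewrite mulSnr big_split_ord big_ord_recr /= -IH.
Qed.

Section Decimation.
Variables (E : fieldType) (p : nat) (j : {rmorphism 'F_p -> E}).
Hypothesis p_pr : prime p.

Let p_gt0 : (0 < p)%N. Proof. exact: prime_gt0. Qed.

Lemma pchar_of_prime_field : p \in [pchar E].
Proof.
by rewrite inE p_pr -(rmorph_nat j) pchar_Fp_0 // rmorph0 eqxx.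
Qed.
Let charE := pchar_of_prime_field.

Lemma prime_digitX c : j c ^+ p = j c.
Proof.
rewrite -(natr_Zp c) rmorph_nat -(pFrobenius_autE charE).
exact: pFrobenius_aut_nat.
Qed.

Lemma ev_frob t P : ev j t P ^+ p = ev j (t ^+ p) P.
Proof.
rewrite !(ev_wide _ _ (leqnn _)) (frob1_sum charE); apply: eq_bigr => i _.
by rewrite exprMn prime_digitX -!exprM mulnC.
Qed.

(** The Cartier operators on polynomials: [P] is the sum of [X^a (decimate a P)(X^p)] over
    [a < p]. *)
Definition decimate a (P : {poly 'F_p}) := \poly_(l < size P) P`_(l * p + a).

Lemma coef_decimate a (P : {poly 'F_p}) l : (decimate a P)`_l = P`_(l * p + a).
Proof.
rewrite coef_poly; case: ltnP => // le; rewrite nth_default //.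
by apply: (leq_trans le); apply: leq_trans (leq_addr _ _); apply: leq_pmulr.
Qed.

Lemma size_decimate a (P : {poly 'F_p}) D :
  (size P <= D * p)%N -> (size (decimate a P) <= D)%N.
Proof.
move=> le; apply/leq_sizeP => l leD; rewrite coef_decimate nth_default //.
by apply: (leq_trans le); apply: leq_trans (leq_addr _ _); 
rewrite leq_mul2r leD orbT.
Qed.

Lemma decimate_neq0 (P : {poly 'F_p}) :
  P != 0 -> exists2 a, (a < p)%N & decimate a P != 0.
Proof.
move=> P0; exists ((size P).-1 %% p)%N; first exact: ltn_pmod.
apply: contraNneq P0 => /(congr1 (fun q : {poly 'F_p} => q`_((size P).-1 %/ p))).
by rewrite coef_decimate -divn_eq coef0 => /eqP; rewrite -lead_coefE lead_coef_eq0.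
Qed.

Lemma ev_decimate t (P : {poly 'F_p}) :
  ev j t P = \sum_(a < p) t ^+ a * ev j t (decimate a P) ^+ p.
Proof.
rewrite (@ev_wide _ _ _ (size P * p)) ?leq_pmulr //.
rewrite (sum_mod _ _ (fun k => j P`_k * t ^+ k)).
apply: eq_bigr => a _.
rewrite ev_frob (@ev_wide _ _ _ (size P)) ?size_poly // big_distrr.
apply: eq_bigr => l _ /=; rewrite coef_decimate -exprM mulrCA -exprD.
by rewrite addnC mulnC.
Qed.

(** The set [S] varies because there are two sources: the whole field when [t] is not a [p]-th
    power, and the ring of series in [t] for every [t]. *)
Definition frob_independent (t : E) (S : set E) :=
  forall y : nat -> E, (forall a, S (y a)) ->
  \sum_(a < p) t ^+ a * y a ^+ p = 0 -> forall a, (a < p)%N -> y a = 0.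

(** If the coefficient of [z] vanishes, splitting the others by Cartier operators writes the
    relation as a sum of [t ^+ a * y a ^+ p]. Independence then kills every [y a], and one of these
    is a shorter nontrivial relation. A nonzero coefficient of [z] makes the additive polynomial
    separable. *)
Lemma separable_relation t (S : set E) z n (b : 'I_n -> {poly 'F_p}) :
  is_subring S -> (forall P, S (ev j t P)) -> S z -> frob_independent t S ->
  (exists i, b i != 0) -> \sum_i ev j t (b i) * z ^+ (p ^ i) = 0 ->
  exists m (c : nat -> {poly 'F_p}), c 0%N != 0 /\
    \sum_(i < m.+1) ev j t (c i) * z ^+ (p ^ i) = 0.
Proof.
move=> hS Sev Sz ind; elim: n b => [|n IH] b [i bi]; first by case: i bi.
have [b0|b0] := eqVneq (b ord0) 0; last first.
  move=> bz; exists n, (fun i => b (inord i)).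
  have -> : inord 0%N = ord0 :> 'I_n.+1 by apply/val_inj; rewrite /= inordK.
  by split => //; rewrite -[RHS]bz; apply: eq_bigr => l _; rewrite inord_val.
rewrite big_ord_recl b0 rmorph0 mul0r add0r => bz.
have [i' {}bi] : exists i', b (lift ord0 i') != 0.
  by case: (unliftP ord0 i) bi => [i' ->|->]; [exists i' | rewrite b0 eqxx].
have [a lta ba] := decimate_neq0 bi.
apply: (IH (fun l => decimate a (b (lift ord0 l)))); first by exists i'.
pose y a := \sum_i ev j t (decimate a (b (lift ord0 i))) * z ^+ (p ^ i).
rewrite -/(y a); apply: ind lta.
  move=> a'; apply: subring_sum => // l _.
  by apply: subringM => //; apply: subringX.
rewrite -[RHS]bz.
under eq_bigr do rewrite (frob1_sum charE) big_distrr /=.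
rewrite exchange_big; apply: eq_bigr => l _ /=.
rewrite [in RHS](ev_decimate t) big_distrl; apply: eq_bigr => a' _ /=.
by rewrite exprMn mulrA -exprM /bump /= add1n expnSr.
Qed.

(** Extracting a [p]-th root lowers the exponent [p ^ i.+1] to [p ^ i], whence the shifted index and
    the zero at [i = n]. *)
Definition cartier n (b h : nat -> {poly 'F_p}) a i : {poly 'F_p} :=
  if (i < n)%N
  then decimate a (b 0%N ^+ (p - 2) * (b 0%N * h i.+1 - h 0%N * b i.+1)) else 0.

(* The relation [b_0 u = \sum_i h_i z^(p^i)] passes from [u] to its Cartier
   components [v_a]: the term [h_0 z] is first eliminated by means of the
   relation satisfied by [z], then the common factor is completed to [b_0^p]. *)
Lemma cartier_step t (S : set E) z n (b h : nat -> {poly 'F_p}) u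
    (v : nat -> E) (a : nat) :
  is_subring S -> (forall P, S (ev j t P)) -> S z -> frob_independent t S ->
  \sum_(i < n.+1) ev j t (b i) * z ^+ (p ^ i) = 0 ->
  ev j t (b 0%N) * u = \sum_(i < n.+1) ev j t (h i) * z ^+ (p ^ i) ->
  (forall a, S (v a)) -> u = \sum_(a < p) t ^+ a * v a ^+ p -> (a < p)%N ->
  ev j t (b 0%N) * v a = \sum_(i < n.+1) ev j t (cartier n b h a i) * z ^+ (p ^ i).
Proof.
move=> hS Sev Sz ind bz hu Sv uE lta; apply/eqP; rewrite -subr_eq0; apply/eqP.
pose y a := ev j t (b 0%N) * v a -
   \sum_(i < n.+1) ev j t (cartier n b h a i) * z ^+ (p ^ i).
rewrite -/(y a); apply: ind lta.
  move=> a'; case: (hS) => _ SB SM; apply: (SB); first exact: SM.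
  by apply: subring_sum => // i _; apply: SM => //; apply: subringX.
have frobB x x' : (x - x') ^+ p = x ^+ p - x' ^+ p :> E.
  by rewrite -(pFrobenius_autE charE) rmorphB.
rewrite /y; under eq_bigr do rewrite frobB mulrBr exprMn.
rewrite sumrB; apply/eqP; rewrite subr_eq0; apply/eqP.
transitivity (ev j t (b 0%N) ^+ p * u).
  by rewrite uE big_distrr; apply: eq_bigr => a' _; rewrite /= mulrCA.
have bp (x : E) : x ^+ p = x ^+ (p - 2) * (x * x).
  by rewrite -expr2 -exprD subnK // prime_gt1.
rewrite bp -!mulrA hu.
have -> : ev j t (b 0%N) * (\sum_(i < n.+1) ev j t (h i) * z ^+ (p ^ i)) =
   ev j t (b 0%N) * (\sum_(i < n.+1) ev j t (h i) * z ^+ (p ^ i)) -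
   ev j t (h 0%N) * (\sum_(i < n.+1) ev j t (b i) * z ^+ (p ^ i)).
  by rewrite bz mulr0 subr0.
have elim (b0 h0 x sh sb : E) : b0 * (h0 * x + sh) - h0 * (b0 * x + sb) =
    b0 * sh - h0 * sb by ring.
rewrite !big_ord_recl elim.
transitivity (\sum_(i < n)
   ev j t (b 0%N ^+ (p - 2) * (b 0%N * h i.+1 - h 0%N * b i.+1)) * z ^+ (p ^ i.+1)).
  rewrite !big_distrr -sumrB big_distrr; apply: eq_bigr => i _ /=.
  rewrite /bump /= !add1n rmorphM rmorphXn rmorphB !rmorphM /=.
  by ring.
under [RHS]eq_bigr => a' _.
  rewrite big_ord_recr /= {2}/cartier ltnn rmorph0 mul0r addr0.
  rewrite (frob1_sum charE) big_distrr /=.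
over.
rewrite exchange_big; apply: eq_bigr => i _ /=.
rewrite (ev_decimate t) big_distrl; apply: eq_bigr => a' _ /=.
by rewrite /cartier ltn_ord exprMn mulrA -exprM expnSr.
Qed.

End Decimation.

(** * Power series and bases over a complete field *)

Section Complete.
Variables (E : fieldType) (w : E -> int).
Hypothesis hw : valuation w.
Hypothesis complete : forall u : nat -> E,
  val_cauchy w u -> exists l : E, val_cvg w u l.
Variables (p : nat) (j : {rmorphism 'F_p -> E}).
Hypothesis p_pr : prime p.

Let charE := pchar_of_prime_field j p_pr.
Let hA := val_ring_subring hw.

Section Base.
Variable t : E.
Hypotheses (t0 : t != 0) (wt : 0 < w t).

Let wt' : 0 <= w t. Proof. exact: ltW. Qed.

Let At : val_ring w t.
Proof. by rewrite /val_ring /= /val_ge wt' orbT. Qed.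

Lemma power_sum_tail (a : nat -> E) (m n : nat) : (n <= m)%N ->
  (forall k, val_ring w (a k)) ->
  val_ge w (n%:Z * w t) (\sum_(k < m) a k * t ^+ k - \sum_(k < n) a k * t ^+ k).
Proof.
move=> le Aa; rewrite -!(big_mkord xpredT (fun k => a k * t ^+ k)).
rewrite (big_cat_nat (leq0n n) le) /= addrAC subrr add0r big_nat_cond.
apply: vge_sum => // k /andP [/andP [lek _] _].
rewrite [a _ * _]mulrC; apply: (@vge_le _ _ _ (k%:Z * w t)).
  by apply: ler_wpM2r; rewrite ?lez_nat.
exact: vge_tX.
Qed.

Lemma digit_sum_tail c (m n : nat) : (n <= m)%N ->
  val_ge w (n%:Z * w t) (digit_sum j t c m - digit_sum j t c n).
Proof.
move=> le; apply: (power_sum_tail (a := fun k => j (c k))) => // k.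
exact: val_ring_prime.
Qed.

Lemma has_digits_exists c : exists z, has_digits w j t c z.
Proof.
have [|l hl] := complete (u := digit_sum j t c).
  (* As [w t] is at least 1, [|N|] digits already give precision [N]. *)
  move=> N; exists `|N|%N => m n lem len.
  have big k : (`|N| <= k)%N ->
      val_ge w N (digit_sum j t c k - digit_sum j t c `|N|).
    move=> /(digit_sum_tail c); apply: vge_le.
    apply: le_trans (ler_norm _) _; rewrite -abszE.
    by rewrite ler_peMr // -gtz0_ge1.
  have -> : digit_sum j t c m - digit_sum j t c n =
    (digit_sum j t c m - digit_sum j t c `|N|) -
    (digit_sum j t c n - digit_sum j t c `|N|) by ring.
  by apply: vgeB => //; apply: big.
exists l => n; have [n0 hn] := hl (n%:Z * w t).
have le1 : (n0 <= maxn n0 n)%N by apply: leq_maxl.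
have -> : l - digit_sum j t c n =
    (digit_sum j t c (maxn n0 n) - digit_sum j t c n) -
    (digit_sum j t c (maxn n0 n) - l) by ring.
by apply: vgeB => //; [apply: digit_sum_tail; apply: leq_maxr | apply: hn].
Qed.

(** For the truncation at [n * p] digits the identity is exact. By additivity of Frobenius the
    remaining errors are [p]-th powers of the errors of the [z a], which only improves them. *)
Lemma has_digits_decimate c (z : nat -> E) :
  (forall a, (a < p)%N -> has_digits w j t (fun n => c (n * p + a)%N) (z a)) ->
  has_digits w j t c (\sum_(a < p) t ^+ a * z a ^+ p).
Proof.
move=> hz n.
have le : (n <= n * p)%N by rewrite leq_pmulr // prime_gt0.
rewrite -[X in X - _](subrK (digit_sum j t c (n * p))) -addrA.
apply: vgeD => //; last exact: digit_sum_tail.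
have -> : digit_sum j t c (n * p) =
    \sum_(a < p) t ^+ a * digit_sum j t (fun n => c (n * p + a)%N) n ^+ p.
  rewrite /digit_sum (sum_mod _ _ (fun k => j (c k) * t ^+ k)).
  apply: eq_bigr => a _; rewrite (frob1_sum charE) big_distrr.
  apply: eq_bigr => l _ /=.
  by rewrite exprMn (prime_digitX j p_pr) mulrCA -exprM -exprD addnC.
rewrite -sumrB; apply: vge_sum => // a _; rewrite -mulrBr.
have -> : z a ^+ p - digit_sum j t (fun n => c (n * p + a)%N) n ^+ p =
    (z a - digit_sum j t (fun n => c (n * p + a)%N) n) ^+ p.
  by rewrite -!(pFrobenius_autE charE) rmorphB.
have hza := hz a (ltn_ord a) n; rewrite -[_ * w t]add0r.
set x := _ - digit_sum _ _ _ _ in hza *.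
apply: vgeM => //.
  exact: (subringX _ hA At).
have Ax : val_ring w x by apply: vge_le hza; rewrite mulr_ge0.
have [p' ->] : exists p', p = p'.+1 by exists p.-1; rewrite prednK // prime_gt0.
rewrite exprS -[_ * w t]addr0; apply: vgeM => //.
exact: (subringX _ hA Ax).
Qed.

Lemma series_decimate z : series_ring w j t z ->
  exists v : nat -> E, (forall a, series_ring w j t (v a)) /\
    z = \sum_(a < p) t ^+ a * v a ^+ p.
Proof.
move=> /(series_digits hw t0 wt) [c hc].
have /choice [v hv] : forall a, exists v,
  has_digits w j t (fun n => c (n * p + a)%N) v by move=> a; apply: has_digits_exists.
exists v; split=> [a|]; first exact: has_digits_series (hv a).
by apply: (has_digits_unique hw wt hc); apply: has_digits_decimate.
Qed.

Lemma series_frob z : series_ring w j t z -> series_ring w j (t ^+ p) (z ^+ p).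
Proof.
move=> Oz n; have [P hP] := Oz n; exists P.
rewrite -(ev_frob j p_pr).
have -> : z ^+ p - ev j t P ^+ p = (z - ev j t P) ^+ p.
  by rewrite -!(pFrobenius_autE charE) rmorphB.
by rewrite valuationX // mulrCA; apply: vgeX.
Qed.

(** The [p]-th power of a series in [t] is a series in [t ^+ p], and [t ^+ a] for [a < p] are
    independent modulo [t ^+ p]. *)
Lemma series_frob_independent : frob_independent p t (series_ring w j t).
Proof.
move=> y Oy y0 a lta.
have t1 : independent_mod w j (t ^+ p)
    (fun bi : 'I_p * 'I_1 => t ^+ bi.1 * 1).
  apply: (@independent_mod_powers _ _ hw _ _ _ _ _ (fun=> 1)) => //.
    by move=> _; case: hA.
  by move=> c; rewrite big_ord1 mulr1 => /(prime_digit_eq0 hw wt) c0 i; rewrite ord1.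
have tp0 : t ^+ p != 0 by rewrite expf_neq0.
have wtp : 0 < w (t ^+ p).
  by rewrite valuationX // mulr_gt0 // ltz_nat prime_gt0.
suff /eqP : y a ^+ p = 0 by rewrite expf_eq0 prime_gt0 //= => /eqP.
apply: (@series_independent _ _ hw _ j _ tp0 wtp _ _
  (fun bi : 'I_p * 'I_1 => y bi.1 ^+ p) _ t1 _ _ (Ordinal lta, ord0)).
- by move=> bi; rewrite mulr1; apply: subringX.
- by move=> bi; apply: series_frob.
rewrite sum_pair -[RHS]y0; apply: eq_bigr => b _.
by rewrite big_ord1 mulr1 mulrC.
Qed.

Lemma digits_combination (I : finType) (g z : I -> E) (c : I -> nat -> 'F_p) x :
  (forall i, val_ring w (g i)) -> (forall i, has_digits w j t (c i) (z i)) ->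
  (forall n : nat, val_ge w (n%:Z * w t)
     (x - \sum_(k < n) (\sum_i j (c i k) * g i) * t ^+ k)) ->
  x = \sum_i z i * g i.
Proof.
move=> Ag hz hx; apply/eqP; rewrite -subr_eq0; apply/eqP.
apply: (vge_eq0 wt) => n.
have -> : x - \sum_i z i * g i =
   (x - \sum_(k < n) (\sum_i j (c i k) * g i) * t ^+ k) -
   \sum_i (z i - digit_sum j t (c i) n) * g i.
  under [in RHS]eq_bigr do rewrite big_distrl /=.
  rewrite exchange_big -addrA -opprD; congr (_ - _); rewrite -big_split.
  apply: eq_bigr => i _ /=; rewrite mulrBl /digit_sum [in X in _ = _ + (_ - X)]big_distrl.
  rewrite addrC -addrA /= [X in _ + X](_ : _ = 0) ?addr0 // addrC -sumrB big1 //.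
  by move=> k _; rewrite mulrAC subrr.
apply: vgeB => //; apply: vge_sum => // i _.
by rewrite -[_ * w t]addr0; apply: vgeM => //; [apply: hz | apply: Ag].
Qed.

(** Take the residue in terms of [g], subtract it, divide by [t] and repeat; by completeness the
    coordinates of the successive residues sum to series. *)
Lemma series_spanning (I : finType) (g : I -> E) x :
  (forall i, val_ring w (g i)) -> spanning_mod w j t g -> val_ring w x ->
  in_span (series_ring w j t) g x.
Proof.
move=> Ag sp Ax.
have /choice [f fP] : forall x, exists cy : (I -> 'F_p) * E, val_ring w x ->
    val_ring w cy.2 /\ x = \sum_i j (cy.1 i) * g i + t * cy.2.
  move=> y; case: (pselect (val_ring w y)) => [/sp [c hc]|]; last first.
    by exists (fun=> 0, 0).
  exists (c, (y - \sum_i j (c i) * g i) / t) => _; split => /=.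
    by rewrite /val_ring /= vge_divl // addr0.
  by rewrite mulrC divfK // addrC subrK.
pose xs n := iter n (fun y => (f y).2) x.
have Axs n : val_ring w (xs n) by elim: n => //= n IH; case: (fP _ IH).
pose c i n := (f (xs n)).1 i.
have /choice [z hz] : forall i, exists z, has_digits w j t (c i) z.
  by move=> i; apply: has_digits_exists.
exists z; first by move=> i; apply: has_digits_series (hz i).
apply: (digits_combination Ag hz) => n.
have -> : x = \sum_(k < n) (\sum_i j (c i k) * g i) * t ^+ k + t ^+ n * xs n.
  elim: n => [|n IH]; first by rewrite big_ord0 add0r expr0 mul1r.
  rewrite {1}IH {1}(fP _ (Axs n)).2 big_ord_recr /= -addrA; congr (_ + _).
  by rewrite mulrDr exprSr mulrA [_ * t ^+ n]mulrC.
by rewrite addrC addKr; apply: vge_tX.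
Qed.

(** Otherwise each independent family in [Q] could be enlarged, as [Q] meets every residue class,
    and would outgrow [N]. The parameter [Q] allows bases inside the digit set as well as bases of
    algebraic elements. *)
Lemma exists_basis (Q : set E) N :
  Q `<=` val_ring w ->
  (forall x, val_ring w x -> exists2 g, Q g & val_ge w (w t) (x - g)) ->
  (forall n (g : 'I_n -> E), (forall i, val_ring w (g i)) ->
     independent_mod w j t g -> (n <= N)%N) ->
  exists n (g : 'I_n -> E),
    [/\ forall i, Q (g i), independent_mod w j t g & spanning_mod w j t g].
Proof.
move=> QA Qt bound; apply: contrapT => nobasis.
suff grow n : exists g : 'I_n -> E, (forall i, Q (g i)) /\ independent_mod w j t g.
  have [g [Qg ind]] := grow N.+1.
  by have := bound _ g (fun i => QA _ (Qg i)) ind; rewrite ltnn.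
elim: n => [|n [g [Qg ind]]].
  by exists (fun=> 0); split=> [[]//|c _ []].
have [x [Ax nx]] : exists x, val_ring w x /\
    forall c : 'I_n -> 'F_p, ~ val_ge w (w t) (x - \sum_i j (c i) * g i).
  apply: contrapT => nox; apply: nobasis; exists n, g; split=> // x Ax.
  apply: contrapT => noc; apply: nox; exists x; split=> // c hc.
  by apply: noc; exists c.
have [g' Qg' xg'] := Qt x Ax.
exists (fun i => if unlift ord_max i is Some i' then g i' else g'); split.
  by move=> i; case: (unlift _ i).
move=> c; rewrite (bigD1_ord ord_max) //= unlift_none.
under eq_bigr do rewrite liftK.
have [cm|cm] := eqVneq (c ord_max) 0.
  rewrite cm rmorph0 mul0r add0r => /ind c0 i.
  by case: (unliftP ord_max i) => [i' ->|->].
move=> hc; case: (nx (fun i => - (c ord_max)^-1 * c (lift ord_max i))).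
have jc0 : j (c ord_max) != 0 by rewrite fmorph_eq0.
have -> : x - \sum_i j (- (c ord_max)^-1 * c (lift ord_max i)) * g i =
   (x - g') + j (c ord_max)^-1 *
     (j (c ord_max) * g' + \sum_i j (c (lift ord_max i)) * g i).
  rewrite fmorphV mulrDr mulKf // -addrA [- g' + _]addKr; congr (_ + _).
  rewrite big_distrr -sumrN; apply: eq_bigr => i _ /=.
  by rewrite rmorphM rmorphN fmorphV mulNr mulNr opprK mulrA.
apply: vgeD => //; rewrite -[w t]add0r; apply: vgeM => //.
exact: val_ring_prime.
Qed.

End Base.
End Complete.

(** * Algebraicity of coordinates *)

Section Coordinates.
Variables (E : fieldType) (w : E -> int).
Hypothesis hw : valuation w.
Hypothesis complete : forall u : nat -> E,
  val_cauchy w u -> exists l : E, val_cvg w u l.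
Variables (p : nat) (j : {rmorphism 'F_p -> E}).
Hypothesis p_pr : prime p.
Variable L : set E.
Hypothesis hL : alg_closed_in L.
(** These hypotheses range over all [t] because the passage from a base to its [p]-th root changes
    [t]. *)
Hypothesis L_relation : forall t z : E, t != 0 -> 0 < w t -> L t -> L z ->
  exists n (b : 'I_n -> {poly 'F_p}),
    (exists i, b i != 0) /\ \sum_(i < n) ev j t (b i) * z ^+ (p ^ i) = 0.
Hypothesis L_dense : forall t x : E, t != 0 -> 0 < w t -> val_ring w x ->
  exists g, [/\ val_ring w g, L g & val_ge w (w t) (x - g)].
Hypothesis bounded : forall t : E, t != 0 -> 0 < w t ->
  exists N, forall n (g : 'I_n -> E), (forall i, val_ring w (g i)) ->
    independent_mod w j t g -> (n <= N)%N.

Let charE := pchar_of_prime_field j p_pr.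
Let hA := val_ring_subring hw.
Let hLS : is_subring L. Proof. by case: hL. Qed.
Let p_gt0 : (0 < p)%N. Proof. exact: prime_gt0. Qed.

Lemma algebraic_prime c : L (j c).
Proof.
rewrite -(natr_Zp c) rmorph_nat; elim: (c : nat) => [|n IH].
  exact: subring0.
by rewrite mulrS; apply: subringD => //; case: hLS.
Qed.

Lemma algebraic_ev t P : L t -> L (ev j t P).
Proof.
move=> Lt; apply: (poly_image_closed hL algebraic_prime Lt).
exact: poly_imageP.
Qed.

Lemma algebraic_frob_root t : L (t ^+ p) -> L t.
Proof.
move=> Lt.
apply: (alg_closed_sparse hL (e := fun i : 'I_2 => if val i == 0%N then 0%N else p)
  (c := fun i => if val i == 0%N then - t ^+ p else 1)).
- by case=> [[|[|//]] ?] [[|[|//]] ?] //= h; apply/val_inj => //=;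
    move: p_gt0; rewrite ?h // -h.
- by move=> i; case: ifP => _; [apply: subringN | case: hLS].
- by exists ord_max; rewrite oner_neq0.
by rewrite !big_ord_recl big_ord0 /= expr0 mulr1 mul1r addr0 addNr.
Qed.

Section Base.
Variable t : E.
Hypotheses (t0 : t != 0) (wt : 0 < w t) (Lt : L t).

Let At : val_ring w t.
Proof. by rewrite /val_ring /= /val_ge ltW // orbT. Qed.
Let hO := series_subring hw j wt.

Lemma series_ev P : series_ring w j t (ev j t P).
Proof. exact/poly_image_series/poly_imageP. Qed.

(** Starting from the trivial identity [c_0 z = c_0 z] for a separable relation of [z], the Cartier
    step expresses [c_0 v_a] through the powers [z ^+ (p ^ i)]. *)
Lemma cartier_algebraic z (v : nat -> E) : L z -> series_ring w j t z ->
  (forall a, series_ring w j t (v a)) -> z = \sum_(a < p) t ^+ a * v a ^+ p ->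
  forall a, (a < p)%N -> L (v a).
Proof.
move=> Lz Oz Ov zE a lta.
have ind := series_frob_independent (j := j) hw p_pr t0 wt.
have [n [b [bi bz]]] := L_relation t0 wt Lt Lz.
have [m [c [c0 cz]]] := separable_relation p_pr hO series_ev Oz ind bi bz.
pose h i := if i == 0%N then c 0%N else 0.
have hz : ev j t (c 0%N) * z = \sum_(i < m.+1) ev j t (h i) * z ^+ (p ^ i).
  rewrite big_ord_recl /= expr1 big1 ?addr0 // => i _.
  by rewrite /h /= rmorph0 mul0r.
have va := cartier_step p_pr hO series_ev Oz ind cz hz Ov zE lta.
have ec0 : ev j t (c 0%N) != 0.
  by apply: contraNneq c0 => /(transcendental_base hw t0 wt) ->.
rewrite -[v a](mulKf ec0) mulrC; apply: (alg_closed_div hL); last first.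
  exact: algebraic_ev.
rewrite va; apply: subring_sum => // i _; apply: subringM => //.
  exact: algebraic_ev.
exact: subringX.
Qed.

Variables (r : nat) (g : 'I_r -> E).
Hypotheses (Ag : forall i, val_ring w (g i)) (Lg : forall i, L (g i)).
Hypotheses (g_ind : independent_mod w j t g) (g_span : spanning_mod w j t g).

Lemma coordinates_unique (c d : 'I_r -> E) :
  (forall i, series_ring w j t (c i)) -> (forall i, series_ring w j t (d i)) ->
  \sum_i c i * g i = \sum_i d i * g i -> forall i, c i = d i.
Proof.
move=> Oc Od cd i; apply/eqP; rewrite -subr_eq0; apply/eqP; move: i.
apply: (series_independent hw t0 wt Ag g_ind (z := fun i => c i - d i)).
  by move=> i; case: (hO) => _ OB _; apply: OB.
by under eq_bigr do rewrite mulrBl; rewrite sumrB cd subrr.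
Qed.

Lemma coordinates_algebraic_separable (z : 'I_r -> E) :
  (forall x, x ^+ p != t) -> (forall i, series_ring w j t (z i)) ->
  L (\sum_i z i * g i) -> forall i, L (z i).
Proof.
move=> npt Oz Lx.
(* [None] stands for [x] and [Some i] for the basis element [g i]. *)
pose y o := if o is Some i then g i else \sum_i z i * g i.
have Ay o : val_ring w (y o).
  case: o => [i|] //=; apply: subring_sum => // i _; apply: subringM => //.
  exact: (series_val_ring hw wt).
have Ly o : L (y o) by case: o.
(* The [y o] need not be series in [t], so independence is required over the whole field; here it
   matters that [t] is not a [p]-th power. *)
have ind : frob_independent p t setT.
  by move=> f _; apply: (frob_power_independent charE npt).
have /choice [m /choice [b hb]] : forall o, exists n (c : nat -> {poly 'F_p}),
    c 0%N != 0 /\ \sum_(i < n.+1) ev j t (c i) * y o ^+ (p ^ i) = 0.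
  move=> o.
  have [n [c [ci cz]]] := L_relation t0 wt Lt (Ly o).
  have hT : is_subring (setT : set E) by split.
  by apply: (separable_relation p_pr hT _ _ ind ci cz).
pose N := \max_o m o.
(* Padding by zeros gives all relations the common length [N.+1]. *)
pose b' o i := if (i <= m o)%N then b o i else 0.
have b'0 o : b' o 0%N != 0 by rewrite /b' leq0n; case: (hb o).
have b'y o : \sum_(i < N.+1) ev j t (b' o i) * y o ^+ (p ^ i) = 0.
  have le : ((m o).+1 <= N.+1)%N by rewrite ltnS /N (leq_bigmax o).
  transitivity (\sum_(i < (m o).+1) ev j t (b o i) * y o ^+ (p ^ i));
    last by case: (hb o).
  rewrite -(big_mkord xpredT (fun i => ev j t (b' o i) * y o ^+ (p ^ i))).
  rewrite (big_cat_nat (leq0n _) le) /= big_mkord [X in _ + X]big1_seq.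
    rewrite addr0; apply: eq_bigr => i _.
    by rewrite /b' -ltnS ltn_ord.
  move=> i /andP [_]; rewrite mem_index_iota => /andP [lt _].
  by rewrite /b' leqNgt lt /= rmorph0 mul0r.
pose D := (option 'I_r * 'I_N.+1)%type.
pose e (k : D) := y k.1 ^+ (p ^ k.2).
pose delta := \prod_o ev j t (b' o 0%N).
(* Block companion matrix: the row of [y o] itself is its relation solved for [y o], scaled by the
   other factors of [delta]; every other row says that an iterated power is the [p]-th power of the
   preceding one. *)
pose A (k l : D) :=
  if k.1 != l.1 then 0 else
  if val k.2 == 0%N then
    if (l.2 < N)%N then
      - (ev j t (b' k.1 l.2.+1) * \prod_(o | o != k.1) ev j t (b' o 0%N)) else 0
  else if l.2.+1 == k.2 then delta else 0.
have SA k l : poly_image j t (A k l).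
  have hS := poly_image_subring j t.
  have Sprod (P : pred (option 'I_r)) :
      poly_image j t (\prod_(o | P o) ev j t (b' o 0%N)).
    by apply: subring_prod => // o _; apply: poly_imageP.
  rewrite /A; case: ifP => _; first exact: subring0.
  case: ifP => _; case: ifP => _; try exact: subring0; last exact: Sprod.
  by apply: subringN => //; apply: subringM => //; apply: poly_imageP.
have eA k : delta * e k = \sum_l A k l * e l ^+ p.
  case: k => o k; rewrite sum_pair (bigD1 o) //= [X in _ + X]big1 => [|o' ne]; last first.
    by rewrite big1 // => l _; rewrite /A /= eq_sym ne mul0r.
  rewrite addr0 /e /A /= eqxx /=.
  case: (unliftP ord0 k) => [k' ->|->] /=.
    pose l0 : 'I_N.+1 := widen_ord (leqnSn N) k'.
    rewrite (bigD1 l0) //= /bump /= add1n eqxx big1 => [|l ne]; last first.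
      rewrite eqSS ifF ?mul0r //; apply: contraNF ne => /eqP h.
      by apply/eqP/val_inj.
    by rewrite addr0 -exprM -expnSr.
  rewrite big_ord_recr /= ltnn mul0r addr0 expn0 expr1.
  move: (b'y o); rewrite big_ord_recl /= expn0 expr1 => /eqP.
  rewrite addr_eq0 => /eqP b0y.
  rewrite /delta (bigD1 o) //= mulrAC b0y mulNr big_distrl -sumrN /=.
  apply: eq_bigr => l _; rewrite ltn_ord /bump /= add1n mulNr -exprM -expnSr.
  by rewrite mulrAC.
have Ae k : val_ring w (e k) by apply: subringX.
have /choice [c cE] : forall k, exists c : 'I_r -> E,
    (forall i, series_ring w j t (c i)) /\ e k = \sum_i c i * g i.
  move=> k.
  have [c Oc ->] := series_spanning hw complete t0 wt Ag g_span (Ae k).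
  by exists c.
(* Nothing is known about the algebraicity of the coordinates of [g i ^+ p]; they form the unknown
   matrix of the self-similar system. *)
have /choice [G GE] : forall i, exists G : 'I_r -> E,
    (forall m, series_ring w j t (G m)) /\ g i ^+ p = \sum_m G m * g m.
  move=> i.
  have Agp : val_ring w (g i ^+ p) by apply: subringX.
  have [c' Oc ->] := series_spanning hw complete t0 wt Ag g_span Agp.
  by exists c'.
have SO x : poly_image j t x -> series_ring w j t x.
  exact: poly_image_series.
have Odelta : series_ring w j t delta.
  by apply: subring_prod => // o _; apply: series_ev.
have cA k i : delta * c k i =
    \sum_l A k l * \sum_n c l n ^+ p * (\matrix_(i, m) G i m) n i.
  move: i; apply: coordinates_unique.
  - by move=> i; apply: (subringM hO Odelta); case: (cE k).
  - move=> i; apply: subring_sum => // l _; apply: (subringM hO); first exact: SO.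
    apply: subring_sum => // n _; apply: (subringM hO).
      by apply: (subringX _ hO); case: (cE l).
    by rewrite mxE; case: (GE n).
  under eq_bigr do rewrite -mulrA.
  rewrite -big_distrr /= -(proj2 (cE k)) eA.
  under [RHS]eq_bigr do rewrite big_distrl /=.
  rewrite exchange_big; apply: eq_bigr => l _ /=.
  under [RHS]eq_bigr do rewrite -mulrA big_distrl /=.
  rewrite -big_distrr /=; congr (_ * _).
  rewrite (proj2 (cE l)) (frob1_sum charE) exchange_big; apply: eq_bigr => n _ /=.
  rewrite exprMn (proj2 (GE n)) big_distrr; apply: eq_bigr => i _ /=.
  by rewrite mxE mulrA.
have cg i i' : c (Some i, ord0) i' = (i == i')%:R.
  move: i'; apply: coordinates_unique.
  - by have [] := cE (Some i, ord0).
  - move=> i'; case: (i == i'); [by case: hO | exact: subring0].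
  rewrite -(proj2 (cE _)) /e /= expn0 expr1 (bigD1 i) //= eqxx mul1r big1 ?addr0 //.
  by move=> i' ne; rewrite eq_sym (negPf ne) mul0r.
have cz i : c (None, ord0) i = z i.
  move: i; apply: coordinates_unique => //; first by case: (cE (None, ord0)).
  by rewrite -(proj2 (cE _)) /e /= expn0 expr1.
move=> i; rewrite -cz.
apply: (self_similar_coordinates charE (poly_image_subring j t) hL _ _ _ SA cA cg).
- exact: poly_image_closed algebraic_prime Lt.
- by apply: subring_prod => // o _; apply: algebraic_ev.
apply/prodf_neq0 => o _; apply: contraNneq (b'0 o).
by move/(transcendental_base hw t0 wt) ->.
Qed.

End Base.

Lemma algebraic_basis (t : E) : t != 0 -> 0 < w t ->
  exists n (g : 'I_n -> E), [/\ forall i, val_ring w (g i) /\ L (g i),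
    independent_mod w j t g & spanning_mod w j t g].
Proof.
move=> t0 wt; have [N bN] := bounded t0 wt.
have QA : [set x | val_ring w x /\ L x] `<=` val_ring w by move=> x [].
have [|n [g [Qg ind sp]]] := exists_basis hw QA _ bN; last by exists n, g.
by move=> x Ax; have [g [Ag Lg h]] := L_dense t0 wt Ax; exists g.
Qed.

(** Induction on [w t], which drops when [t = s ^+ p]. The coordinates over [s] are algebraic by
    induction, hence so are those in the basis [be] modulo [t]. Passing from [be] to the given basis
    [g] is done by a linear relation with algebraic series coefficients between [x] and the
    [g i]. *)
Lemma coordinates_algebraic (t : E) r (g z : 'I_r -> E) :
  t != 0 -> 0 < w t -> L t ->
  (forall i, val_ring w (g i)) -> (forall i, L (g i)) ->
  independent_mod w j t g -> spanning_mod w j t g ->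
  (forall i, series_ring w j t (z i)) ->
  L (\sum_i z i * g i) -> forall i, L (z i).
Proof.
have [n] := ubnP `|w t|%N; elim: n => // n IH in t r g z *.
move=> lt t0 wt Lt Ag Lg ind sp Oz Lx.
have [[s st]|nst] := pselect (exists x, x ^+ p = t); last first.
  apply: (coordinates_algebraic_separable t0 wt Lt Ag Lg ind sp _ Oz Lx) => x.
  by apply/eqP => xt; apply: nst; exists x.
subst t.
have s0 : s != 0 by apply: contraNneq t0 => ->; rewrite expr0n eqn0Ngt p_gt0.
have ws : 0 < w s by move: wt; rewrite valuationX // pmulr_rgt0 // ltz_nat.
have Ls : L s := algebraic_frob_root Lt.
have {}IH := IH s _ _ _ _ s0 ws Ls.
have {lt} lts : (`|w s| < n)%N.
  move: lt; rewrite valuationX // abszM absz_nat ltnS; apply: leq_trans.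
  by rewrite ltn_Pmull ?prime_gt1 // absz_gt0 gt_eqF.
have [d [f [ALf f_ind f_sp]]] := algebraic_basis s0 ws.
have Af i : val_ring w (f i) by case: (ALf i).
have Lf i : L (f i) by case: (ALf i).
pose be (bi : 'I_p * 'I_d) := s ^+ bi.1 * f bi.2.
have be_ind : independent_mod w j (s ^+ p) be by apply: independent_mod_powers.
have As : val_ring w s by rewrite /val_ring /= /val_ge ltW // orbT.
have Abe bi : val_ring w (be bi) by apply: subringM => //; apply: subringX.
have hO := series_subring hw j wt.
(* The independent family [be] lies in the span of [g] over the series in [s ^+ p]. *)
have le : (p * d <= r)%N.
  rewrite leqNgt; apply/negP => lt.
  have [||c [Oc [bi cbi] cbe]] := @dependent_span _ (series_ring w j (s ^+ p))
    _ _ g be hO.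
  - by rewrite card_prod !card_ord.
  - by move=> bi; apply: series_spanning.
  by case/eqP: cbi; apply: (series_independent hw t0 wt Abe be_ind Oc cbe).
pose x o := if o is Some i then g i else \sum_i z i * g i.
have Ax o : val_ring w (x o).
  case: o => [i|] //=; apply: subring_sum => // i _; apply: subringM => //.
  exact: (series_val_ring hw wt).
have Lxo o : L (x o) by case: o.
pose OL := series_ring w j (s ^+ p) `&` L.
have hOL : is_subring OL.
  case: (hO) (hLS) => O1 OB OM [L1 LB LM]; split=> //.
    by move=> u v [Ou Lu] [Ov Lv]; split; [apply: OB | apply: LB].
  by move=> u v [Ou Lu] [Ov Lv]; split; [apply: OM | apply: LM].
(* The [r.+1] elements [g i] and [x] lie in the span of at most [r] elements. The coefficients are
   [v a ^+ p], where [v a] are the Cartier components of the coordinates over [s]: these are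
   algebraic series in [s ^+ p]. *)
have [||c [OLc [o co] cx]] := @dependent_span _ OL _ _ be x hOL.
- by rewrite card_prod card_option !card_ord.
- move=> o.
  have [u Ou xE] := series_spanning hw complete s0 ws Af f_sp (Ax o).
  have Lu : forall i, L (u i) by apply: IH lts _ Lf f_ind f_sp Ou _ => //; rewrite -xE.
  rewrite xE; apply: in_span_sum => // i _.
  have [v [Ov uE]] := series_decimate hw complete p_pr s0 ws (Ou i).
  have Lv := cartier_algebraic s0 ws Ls (Lu i) (Ou i) Ov uE.
  rewrite uE big_distrl; apply: in_span_sum => // a _ /=.
  have -> : s ^+ a * v a ^+ p * f i = v a ^+ p * be (a, i).
    by rewrite /be /= mulrAC mulrC.
  apply: in_spanZ => //; last exact: in_span_gen.
  by split; [apply: series_frob | apply: subringX; last exact: Lv].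
have Oc o' : series_ring w j (s ^+ p) (c o') by case: (OLc o').
have Lc o' : L (c o') by case: (OLc o').
have rel : forall i, c (Some i) + c None * z i = 0.
  apply: (series_independent hw t0 wt Ag ind
    (z := fun i => c (Some i) + c None * z i)) => [i|].
    exact: (subringD hO (Oc _) (subringM hO (Oc _) (Oz _))).
  rewrite -[RHS]cx (bigD1 None) //= big_distrr (reindex_omap Some id) /=.
    under [X in _ = _ + X]eq_bigl do rewrite eqxx.
    rewrite -big_split; apply: eq_bigr => i _ /=.
    by rewrite mulrDl addrC mulrA.
  by case.
(* Were the coefficient of [x] zero, [rel] would make all other coefficients zero too. *)
have cN : c None != 0.
  apply: contraNneq co => cN; case: o => [i|]; last by rewrite cN.
  by have := rel i; rewrite cN mul0r addr0 => ->.
move=> i; have /eqP := rel i; rewrite addrC addr_eq0 => /eqP h.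
rewrite -[z i](mulKf cN) h mulrC; apply: (alg_closed_div hL) => //.
exact: subringN.
Qed.

End Coordinates.

(** * Automatic sequences and Christol's theorem *)

Section Automatic.
Variable p : nat.
Hypothesis p_pr : prime p.

Lemma p_kernel_self (T : Type) (a : nat -> T) : p_kernel p a a.
Proof. by exists 0%N, 0%N; split => //; apply/funext => n; rewrite muln1 addn0. Qed.

Lemma p_kernel_step (T : Type) (a s : nat -> T) d : (d < p)%N ->
  p_kernel p a s -> p_kernel p a (fun n => s (n * p + d)%N).
Proof.
move=> ltd [i [k [ltk ->]]]; exists i.+1, (d * p ^ i + k)%N; split.
  rewrite expnS; apply: (@leq_trans (d * p ^ i + p ^ i)%N); first by rewrite ltn_add2l.
  by rewrite addnC -mulSn leq_mul2r ltd orbT.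
by apply/funext => n; congr a; rewrite expnS; ring.
Qed.

(** The [p]-kernel is generated from [a] by the [p] decimation maps: the top base-[p] digit of the
    offset [k] is split off as the last map applied. *)
Lemma p_kernel_ind (T : Type) (a : nat -> T) (P : (nat -> T) -> Prop) :
  P a -> (forall s d, (d < p)%N -> P s -> P (fun n => s (n * p + d)%N)) ->
  forall s, p_kernel p a s -> P s.
Proof.
move=> Pa Pstep _ [i [k [ltk ->]]]; elim: i k ltk => [|i IH] k ltk.
  suff -> : (fun n => a (n * p ^ 0 + k)%N) = a by [].
  by apply/funext => n; case: k ltk => // _; rewrite muln1 addn0.
have q0 : (0 < p ^ i)%N by rewrite expn_gt0 prime_gt0.
have ltd : (k %/ p ^ i < p)%N by rewrite ltn_divLR // -expnS.
have := Pstep _ _ ltd (IH (k %% p ^ i)%N (ltn_pmod _ q0)).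
congr P; apply/funext => n; congr a.
rewrite {3}(divn_eq k (p ^ i)) expnS; ring.
Qed.

Lemma automatic_map (T U : Type) (h : T -> U) (a : nat -> T) :
  automatic p a -> automatic p (h \o a).
Proof.
move=> fa; rewrite /automatic.
apply: (@sub_finite_set _ _ ((fun s => h \o s) @` p_kernel p a)); last first.
  exact: finite_image.
move=> _ [i [k [ltk ->]]]; exists (fun n => a (n * p ^ i + k)%N) => //.
by exists i, k.
Qed.

Lemma automatic_enum (T : Type) (a : nat -> T) : automatic p a ->
  exists N (e : nat -> nat -> T), forall s, p_kernel p a s <->
    exists2 k, (k < N)%N & s = e k.
Proof.
move=> fa.
(* Classical equality on sequences, so that the finite kernel can be listed as a [seq]. *)
pose U : eqType := {classic (nat -> T)}.
have /finite_seqP [s sE] : finite_set (p_kernel p a : set U) by exact: fa.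
exists (size s), (nth (a : U) s) => u; rewrite sE; split => /=.
  move=> us; exists (index (u : U) s); first by rewrite index_mem.
  by rewrite nth_index.
by case=> k ltk ->; apply: mem_nth.
Qed.

(** A kernel sequence of the combination is determined by one kernel sequence of each [c i], and
    there are finitely many such tuples. *)
Lemma automatic_finfun (T U : Type) (I : finType) (c : I -> nat -> T)
    (h : (I -> T) -> U) :
  (forall i, automatic p (c i)) -> automatic p (fun n => h (fun i => c i n)).
Proof.
move=> ac; have /choice [N /choice [e eP]] := fun i => automatic_enum (ac i).
pose M := \max_i N i.
have fin := @finite_finset {ffun I -> 'I_M.+1} setT.
rewrite /automatic; apply: (@sub_finite_set _ _
  ((fun (k : {ffun I -> 'I_M.+1}) n => h (fun i => e i (k i) n)) @` setT)); last first.
  by apply: finite_image; exact: fin.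
move=> _ [i [d [ltd ->]]].
have /choice [k kP] : forall l, exists k : 'I_M.+1,
    (fun n => c l (n * p ^ i + d)%N) = e l k.
  move=> l; have /eP [k ltk ->] : p_kernel p (c l) (fun n => c l (n * p ^ i + d)%N).
    by exists i, d.
  have ltM : (k < M.+1)%N.
    by rewrite ltnS; apply: leq_trans (ltnW ltk) _; rewrite /M (leq_bigmax l).
  by exists (Ordinal ltM).
exists [ffun l => k l] => //; apply/funext => n; congr h; apply/funext => l.
by rewrite ffunE -kP.
Qed.

Lemma automatic_finite_support (T : Type) (z g : T) :
  automatic p (fun n => if n == 0%N then g else z).
Proof.
set a := fun n => _.
apply: (@sub_finite_set _ _ [set a; fun=> z]); last exact: finite_set2.
move=> _ [i [k [ltk ->]]]; case: (posnP k) => [->|k0]; [left | right].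
  have q0 : (p ^ i == 0)%N = false by rewrite expn_eq0 (gtn_eqF (prime_gt0 p_pr)).
  by apply/funext => n; rewrite /a addn0 muln_eq0 q0 orbF.
by apply/funext => n; rewrite /a addn_eq0 (gtn_eqF k0) andbF.
Qed.

End Automatic.

Section Christol.
Variables (E : fieldType) (w : E -> int).
Hypothesis hw : valuation w.
Hypothesis complete : forall u : nat -> E,
  val_cauchy w u -> exists l : E, val_cvg w u l.
Variables (p : nat) (j : {rmorphism 'F_p -> E}).
Hypothesis p_pr : prime p.
Variable L : set E.
Hypothesis hL : alg_closed_in L.
Hypothesis L_relation : forall t z : E, t != 0 -> 0 < w t -> L t -> L z ->
  exists n (b : 'I_n -> {poly 'F_p}),
    (exists i, b i != 0) /\ \sum_(i < n) ev j t (b i) * z ^+ (p ^ i) = 0.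

Variable t : E.
Hypotheses (t0 : t != 0) (wt : 0 < w t) (Lt : L t).
Variables (c : nat -> 'F_p) (z : E).
Hypothesis zc : has_digits w j t c z.

Let p_gt0 : (0 < p)%N. Proof. exact: prime_gt0. Qed.
Let charE := pchar_of_prime_field j p_pr.

(** The series of the kernel sequences form a self-similar vector with scalar 1: each is the sum of
    [t ^+ d] times the [p]-th power of the series of its [d]-th decimation, again in the kernel. *)
Lemma automatic_digits_algebraic : automatic p c -> L z.
Proof.
move=> /automatic_enum [N [e eP]].
have /choice [om omP] : forall k, exists z, has_digits w j t (e k) z.
  by move=> k; apply: has_digits_exists.
have /eP [k0 ltk0 ck0] := p_kernel_self p c.
have -> : z = om k0 by apply: (has_digits_unique hw wt zc); rewrite ck0.
have step (k : 'I_N) : in_span (poly_image j t)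
    (fun l : 'I_N => 1 * om l ^+ p) (om k).
  have /choice [s sP] : forall d : 'I_p, exists l : 'I_N,
      (fun n => e k (n * p + d)%N) = e l.
    move=> d; have /eP [l ltl ->] : p_kernel p c (fun n => e k (n * p + d)%N).
      by apply: p_kernel_step => //; apply/eP; exists k.
    by exists (Ordinal ltl).
  have -> : om k = \sum_(d < p) t ^+ d * om (s d) ^+ p.
    have := @has_digits_decimate _ _ hw _ j p_pr t t0 wt (e k)
      (fun d => if insub d is Some d' then om (s d') else 0).
    under eq_bigr do rewrite valK.
    move=> H; apply: (has_digits_unique hw wt (omP k)); apply: H => d ltd.
    by rewrite insubT /= (sP (Ordinal ltd)).
  have hS := poly_image_subring j t.
  apply: in_span_sum => // d _; apply: in_spanZ => //.
    by apply: subringX => //; exists 'X; rewrite evX.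
  rewrite -[_ ^+ p]mul1r.
  exact: (@in_span_gen _ _ _ (fun l : 'I_N => 1 * om l ^+ p)).
apply: (self_similar_algebraic charE (poly_image_subring j t) hL _ step (Ordinal ltk0)).
- exact: (poly_image_closed hL (algebraic_prime j hL) Lt).
- exact: oner_neq0.
by case: hL => -[].
Qed.

(** Every kernel sequence has a series [u] such that [b_0 u] is a combination of the [z ^+ (p ^ i)]
    whose coefficients have size at most [D]. Over a finite field there are finitely many such
    combinations. *)
Lemma algebraic_digits_automatic : L z -> automatic p c.
Proof.
move=> Lz; have Oz := has_digits_series zc.
have hO := series_subring hw j wt.
have Sev := series_ev w j t.
have ind := series_frob_independent (j := j) hw p_pr t0 wt.
have [n [b0 [bi bz0]]] := L_relation t0 wt Lt Lz.
have [m [b [b00 bz]]] := separable_relation p_pr hO Sev Oz ind bi bz0.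
pose D := \max_(i < m.+1) size (b i).
have bD i : (i <= m)%N -> (size (b i) <= D)%N.
  by rewrite -ltnS => lt; rewrite /D (leq_bigmax (Ordinal lt)).
have D0 : (0 < D)%N by apply: leq_trans (bD 0%N _); rewrite // lt0n size_poly_eq0.
have eb0 : ev j t (b 0%N) != 0.
  by apply: contraNneq b00 => /(transcendental_base hw t0 wt) ->.
pose good s := exists u (h : nat -> {poly 'F_p}), [/\ has_digits w j t s u,
  forall i, (size (h i) <= D)%N &
  ev j t (b 0%N) * u = \sum_(i < m.+1) ev j t (h i) * z ^+ (p ^ i)].
have good_kernel : forall s, p_kernel p c s -> good s.
  apply: (p_kernel_ind p_pr).
    exists z, (fun i => if i == 0%N then b 0%N else 0); split=> // [i|].
      by case: ifP => _; rewrite ?bD // size_poly0.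
    rewrite big_ord_recl /= expn0 expr1 big1 ?addr0 // => i _.
    by rewrite rmorph0 mul0r.
  move=> s d ltd [u [h [su hD hu]]].
  have /choice [v vP] : forall a, exists v, has_digits w j t (fun n => s (n * p + a)%N) v.
    by move=> a; apply: has_digits_exists.
  have uE : u = \sum_(a < p) t ^+ a * v a ^+ p.
    by apply: (has_digits_unique hw wt su); apply: has_digits_decimate.
  have Ov a : series_ring w j t (v a) := has_digits_series (vP a).
  exists (v d), (cartier m b h d); split=> // [i|]; last first.
    exact: (cartier_step p_pr hO Sev Oz ind bz hu Ov uE ltd).
  rewrite /cartier; case: ltnP => lti; last by rewrite size_poly0.
  apply: size_decimate => //.
  have szM (P Q : {poly 'F_p}) : (size P <= D)%N -> (size Q <= D)%N ->
      (size (P * Q)%R <= (D.-1 * 2).+1)%N.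
    by move=> hP hQ; apply: leq_trans (size_polyMleq P Q) _; lia.
  have sz1 : (size (b 0%N * h i.+1 - h 0%N * b i.+1)%R <= (D.-1 * 2).+1)%N.
    apply: leq_trans (size_polyD _ _) _; rewrite size_polyN geq_max.
    by rewrite !szM ?bD.
  have sz2 : (size (b 0%N ^+ (p - 2)) <= (D.-1 * (p - 2)).+1)%N.
    apply: leq_trans (size_poly_exp_leq _ _) _; rewrite ltnS leq_mul2r.
    by apply/orP; right; have := bD 0%N (leq0n _); lia.
  (* The product has degree at most [D.-1 * p], hence size at most [D * p], and decimation brings
     the bound back to [D]. *)
  apply: leq_trans (size_polyMleq _ _) _.
  have := prime_gt1 p_pr; nia.
pose val_of (k : {ffun 'I_m.+1 * 'I_D -> 'F_p}) :=
  \sum_(i < m.+1) (\sum_(l < D) j (k (i, l)) * t ^+ l) * z ^+ (p ^ i).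
(* As [b 0] does not vanish at [t], a coefficient tuple determines [u] and so its digits; [c] is a
   dummy value for tuples that come from no series. *)
have /choice [G GP] : forall k, exists s0, forall s u, has_digits w j t s u ->
    ev j t (b 0%N) * u = val_of k -> s = s0.
  move=> k; have [[s0 [u0 [su0 uk0]]]|no] := pselect (exists s u,
     has_digits w j t s u /\ ev j t (b 0%N) * u = val_of k).
    exists s0 => s u su uk; apply: (digits_unique hw t0 wt su).
    suff -> : u = u0 by [].
    by apply: (mulfI eb0); rewrite uk.
  by exists c => s u su uk; case: no; exists s, u.
have fin := @finite_finset {ffun 'I_m.+1 * 'I_D -> 'F_p} setT.
apply: (@sub_finite_set _ _ (G @` setT)); last exact: finite_image.
move=> s /good_kernel [u [h [su hD hu]]].
exists [ffun il : 'I_m.+1 * 'I_D => (h il.1)`_il.2] => //; apply/esym/(GP _ _ _ su).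
rewrite hu; apply: eq_bigr => i _; congr (_ * _).
by rewrite (ev_wide _ _ (hD i)); apply: eq_bigr => l _; rewrite ffunE.
Qed.

End Christol.

(** * Expansions in the completion *)

Section Completion.
Variables (p : nat) (K : fieldType) (v : K -> int) (Kv : fieldType).
Variables (w : Kv -> int) (iota : {rmorphism K -> Kv}).
Hypotheses (p_pr : prime p) (hvnorm : normalized v) (hKv : is_completion v w iota).
Variables (f : {rmorphism 'F_p -> K}) (x0 : K).
Hypothesis hx0 : finite_degree_over (simple_ext f x0).

Local Notation j := (iota \o f).
Let hw : valuation w := completion_valuation hKv.
Let complete := completion_complete hKv.
Let hL := algebraicOver_closed iota.

Lemma completion_relation (t z : Kv) : t != 0 -> 0 < w t ->
  algebraicOver iota t -> algebraicOver iota z ->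
  exists n (b : 'I_n -> {poly 'F_p}),
    (exists i, b i != 0) /\ \sum_(i < n) ev j t (b i) * z ^+ (p ^ i) = 0.
Proof.
move=> t0 wt Lt Lz; apply: (algebraic_additive_relation hx0) => //.
exact: transcendental_base wt.
Qed.

Lemma completion_algebraic_dense (t x : Kv) : t != 0 -> 0 < w t ->
  val_ring w x -> exists g,
    [/\ val_ring w g, algebraicOver iota g & val_ge w (w t) (x - g)].
Proof.
move=> t0 wt Ax; have [a ha] := completion_dense hKv x (w t).
exists (iota a); split=> //; last exact: algebraic_id.
rewrite -[iota a](subKr x) /val_ring /=; apply: vgeB => //.
by apply: vge_le ha; apply: ltW.
Qed.

(* Residues are represented in [K], which is finite over [F_p(tau)] for any
   [tau] in [K] of the same valuation as [t]. *)
Lemma independent_mod_bounded (t : Kv) : t != 0 -> 0 < w t ->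
  exists N, forall n (g : 'I_n -> Kv), (forall i, val_ring w (g i)) ->
    independent_mod w j t g -> (n <= N)%N.
Proof.
move=> t0 wt; have [a a0 va] := hvnorm (w t).
pose tau := iota a.
have tau0 : tau != 0 by rewrite fmorph_eq0.
have wtau : w tau = w t by rewrite (completion_extends hKv).
have wtau0 : 0 < w tau by rewrite wtau.
have [J [h fK]] := finite_over_transcendental hx0 (algebraic_id iota a)
  (transcendental_base hw tau0 wtau0).
exists #|J| => n g Ag ind; rewrite leqNgt; apply/negP => lt.
have /fin_all_exists [y yg] : forall i, exists y, val_ge w (w t) (g i - iota y).
  by move=> i; apply: completion_dense hKv _ _.
(* More than [#|J|] elements of [K] are dependent over [F_p[tau]]. Being congruent to the [g i],
   they are also independent modulo [tau], hence over all series in [tau]. *)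
have [||c [Sc [i ci] cy]] :=
    @finite_over_dependent _ _ _ _ _ _ (iota \o y) (poly_image_subring j tau) fK.
- by move=> i; exists (y i).
- by rewrite card_ord.
case/eqP: ci; move: i.
apply: (series_independent (j := j) hw tau0 wtau0 (g := iota \o y)) => [i||i|//].
- rewrite -[_ i](subKr (g i)) /val_ring /=; apply: vgeB => //; first exact: Ag.
  by apply: vge_le (yg i); apply: ltW.
- move=> d; rewrite wtau => hd; apply: ind.
  have -> : \sum_i j (d i) * g i =
      \sum_i j (d i) * (iota \o y) i + \sum_i j (d i) * (g i - iota (y i)).
    by rewrite -big_split; apply: eq_bigr => i _ /=; ring.
  apply: vgeD => //; apply: vge_sum => // i _; rewrite -[w t]add0r.
  apply: vgeM => //; exact: (@val_ring_prime _ _ hw _ j).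
exact/poly_image_series/Sc.
Qed.

(** Reduces to expansions starting at 0 and replaces the limit by congruences modulo every
    [pi ^+ n]: terms of index at least [n] do not affect them. *)
Lemma shift_expansion (Gamma : set Kv) (pi x : Kv) (m : int) (a : nat -> Kv) :
  pi != 0 -> 0 < w pi -> Gamma `<=` val_ring w ->
  expansion w Gamma pi x m a -> forall n : nat,
  val_ge w (n%:Z * w pi) (x / pi ^ m - \sum_(k < n) a k * pi ^+ k).
Proof.
move=> pi0 wpi GA [Ga hx] n.
have pim0 : pi ^ m != 0 by rewrite expfz_neq0.
have [n0 hn0] := hx (w (pi ^ m) + n%:Z * w pi).
pose M := maxn n0 n; have leM : (n <= M)%N by apply: leq_maxr.
have hM := hn0 M (leq_maxl _ _).
have tail := power_sum_tail hw pi0 wpi leM (fun k => GA _ (Ga k)).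
have head : val_ge w (n%:Z * w pi) (\sum_(k < M) a k * pi ^+ k - x / pi ^ m).
  rewrite -(vge_mull hw _ _ pim0) mulrBr [_ * (x / _)]mulrC divfK //.
  suff -> : pi ^ m * \sum_(k < M) a k * pi ^+ k =
      \sum_(k < M) a k * pi ^ (m + k%:Z) by [].
  rewrite big_distrr; apply: eq_bigr => k _ /=.
  by rewrite expfzDr // mulrCA.
set s := \sum_(k < M) _ in tail head.
have -> : x / pi ^ m - \sum_(k < n) a k * pi ^+ k =
  (s - \sum_(k < n) a k * pi ^+ k) - (s - x / pi ^ m) by ring.
exact: vgeB.
Qed.

End Completion.

(** * Property B for additively closed digit sets *)

Theorem theorem3p5 (p : nat) (K : fieldType) (v : K -> int)
    (Kv : fieldType) (w : Kv -> int) (iota : {rmorphism K -> Kv})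
    (pi : Kv) (Gamma : set Kv)
    (hK : global_function_field p K)
    (hv : valuation v) (hvnorm : normalized v) (hvnontriv : nontrivial_val v)
    (hKv : is_completion v w iota)
    (hpi0 : pi != 0) (hpi : 0 < w pi)
    (hGamma : complete_reps w pi Gamma)
    (hadd : forall mu nu : Kv, Gamma mu -> Gamma nu -> Gamma (mu + nu)) :
  property_B p iota w Gamma pi <->
  (algebraicOver iota pi /\ forall g : Kv, Gamma g -> algebraicOver iota g).
Proof.
case: hK => p_pr [f [x0 [_ hx0]]].
pose j : {rmorphism 'F_p -> Kv} := iota \o f.
have hw := completion_valuation hKv; have complete := completion_complete hKv.
have hL := algebraicOver_closed iota; have [hLS _] := hL.
have [GA Grep] := hGamma.
have hA := val_ring_subring hw.
have [g1 [Gg1 _] _] : exists2 g, Gamma g /\ True & True.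
  by have [g [[Gg _] _]] := Grep 1 (let: And3 h _ _ := hA in h); exists g.
have GMn g n : Gamma g -> Gamma (g *+ n.+1).
  by move=> Gg; elim: n => // n IH; rewrite mulrS; apply: hadd.
have charE := pchar_of_prime_field j p_pr.
(* The sum of [p] copies of any element of [Gamma] is 0; likewise scalars from the prime field act
   by repeated addition. *)
have G0 : Gamma 0.
  have := GMn g1 p.-1 Gg1; rewrite prednK ?prime_gt0 //.
  by rewrite -mulr_natr (pcharf0 charE) mulr0.
have GZ c g : Gamma g -> Gamma (j c * g).
  move=> Gg; rewrite -(natr_Zp c) rmorph_nat mulr_natl.
  by case: (nat_of_ord c) => [|n]; [rewrite mulr0n | apply: GMn].
have Gsum (I : finType) (F : I -> Kv) : (forall i, Gamma (F i)) -> Gamma (\sum_i F i).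
  by move=> GF; elim/big_ind: _.
have Gex x : val_ring w x -> exists2 g, Gamma g & val_ge w (w pi) (x - g).
  move=> /Grep [g [[Gg [y Ay xg]] _]]; exists g => //.
  by rewrite xg; apply: val_ring_mul => //; apply: ltW.
have Guniq g h : Gamma g -> Gamma h -> val_ge w (w pi) (g - h) -> g = h.
  move=> Gg Gh gh; have [k [_ ku]] := Grep g (GA g Gg).
  rewrite -(ku g); last first.
    by split=> //; exists 0; [apply: subring0 | rewrite mulr0 subrr].
  apply: ku; split=> //; exists ((g - h) / pi); last by rewrite mulrC divfK.
  by rewrite /val_ring /= vge_divl // addr0.
split=> [hB|[Lpi LG]].
  (* The digits [g, 0, 0, ...] starting at index [m] expand [g * pi ^ m]. *)
  have single (g : Kv) (m : int) : Gamma g -> algebraicOver iota (g * pi ^ m).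
    move=> Gg; pose a n := if n == 0%N then g else 0.
    apply/(hB _ m a); last exact: automatic_finite_support.
    split; first by move=> k; rewrite /a; case: ifP.
    move=> N; exists 1%N => -[//|n] _.
    rewrite big_ord_recl /a /= addr0 big1 ?addr0 ?subrr ?vge_0 // => i _.
    by rewrite mul0r.
  have LG g : Gamma g -> algebraicOver iota g.
    by move=> Gg; rewrite -[g]mulr1 -(expr0z pi); apply: single.
  split=> //.
  (* The representative of 1 is a nonzero digit, so [pi] is the quotient of [g * pi] by [g]. *)
  have [g Gg hg] := Gex 1 (let: And3 h _ _ := hA in h).
  have g0 : g != 0.
    apply: contraTneq hg => ->; rewrite subr0 /val_ge oner_eq0 valuation1 //=.
    by rewrite -ltNge.
  rewrite -[pi](mulKf g0) mulrC -{1}(expr1z pi).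
  by apply: alg_closed_div => //; [apply: single | apply: LG].
have Lrel := completion_relation hKv hx0.
have [N bN] := independent_mod_bounded hvnorm hKv hx0 hpi0 hpi.
(* The basis is chosen inside [Gamma], so a combination of it is again a digit and a congruence
   between digits becomes an equality. *)
have [r [g [Gg g_ind g_span]]] := exists_basis hw GA Gex bN.
have Ag i : val_ring w (g i) by apply: GA.
have Lg i : algebraicOver iota (g i) by apply: LG.
have /choice [C CE] : forall h, exists c : 'I_r -> 'F_p,
    Gamma h -> h = \sum_i j (c i) * g i.
  move=> h; case: (pselect (Gamma h)) => [Gh|]; last by exists (fun=> 0).
  have [c hc] := g_span h (GA _ Gh); exists c => _.
  by apply: Guniq => //; apply: Gsum => i; apply: GZ.
move=> x m a ax; have [Ga _] := ax.
have sE := shift_expansion hKv hpi0 hpi GA ax.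
pose c i k := C (a k) i.
have /choice [z zc] : forall i, exists z, has_digits w j pi (c i) z.
  by move=> i; apply: has_digits_exists.
(* The digits of [z i] are the coordinates of the digits of [x], so automaticity passes between [a]
   and the family [c]. *)
have xE : x / pi ^ m = \sum_i z i * g i.
  apply: (digits_combination hw hpi Ag zc) => n.
  under eq_bigr do rewrite -(CE _ (Ga _)).
  exact: sE.
have Lpim : algebraicOver iota (pi ^ m).
  case: (m) => n; first by rewrite -exprnP; apply: subringX.
  by rewrite NegzE -exprnN; apply: alg_closedV => //; apply: subringX.
have pim0 : pi ^ m != 0 by rewrite expfz_neq0.
split=> [Lx|auto_a].
  have Lz : forall i, algebraicOver iota (z i).
    apply: (coordinates_algebraic hw complete p_pr hL Lrel _ _ hpi0 hpi Lpi Ag Lg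
             g_ind g_span).
    - exact: completion_algebraic_dense hKv.
    - by move=> t t0 wt; have := independent_mod_bounded hvnorm hKv hx0 t0 wt.
    - by move=> i; apply: has_digits_series (zc i).
    by rewrite -xE; apply: alg_closed_div.
  have auto_c i : automatic p (c i).
    exact: (algebraic_digits_automatic hw complete p_pr Lrel hpi0 hpi Lpi (zc i)).
  have -> : a = (fun n => \sum_i j (c i n) * g i).
    by apply/funext => n; rewrite {1}(CE _ (Ga n)).
  exact: (automatic_finfun (fun d => \sum_i j (d i) * g i) auto_c).
have Lz i : algebraicOver iota (z i).
  apply: (automatic_digits_algebraic hw complete p_pr hL hpi0 hpi Lpi (zc i)).
  exact: (automatic_map (fun h => C h i) auto_a).
rewrite -[x](divfK pim0) xE; apply: subringM => //; apply: subring_sum => // i _.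
exact: subringM.
Qed.
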